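(* Let $m,n$ be positive integers satisfying $m\ge n\ge 1$ and $m+n\equiv 0\pmod 2$, and let $\varepsilon\in\{0,1\}$. Then \[ \int_0^1 \frac{x^m}{(1-x^2)^{(1-\varepsilon)/2}\,(\operatorname{arctanh} x)^n}\,dx = (-1)^{(m-n)/2} \sum_{p=\lceil n/2\rceil}^{(m+n)/2} \binom{2p-1+\varepsilon}{n-1} \frac{\Phi\!\left(2\varepsilon-1,\,2p+\varepsilon,\,\frac12\right)}{\pi^{2p-1+\varepsilon}}\, [z^{m+\varepsilon}]\,(1-z^2)^{(m-1)/2}(\arcsin z)^{2p-n+\varepsilon}. \] The choices $\varepsilon=0$ and $\varepsilon=1$ yield, respectively, the Dirichlet-beta and zeta--lambda identities, i.e. $\Phi(2\varepsilon-1,2p+\varepsilon,\frac12)$ equals $2^{2p}\beta(2p)$ for $\varepsilon=0$ and $2^{2p+1}\lambda(2p+1)=(2^{2p+1}-1)\zeta(2p+1)$ for $\varepsilon=1$.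
   Context: $\Phi(q,s,a)=\sum_{j=0}^{\infty}\frac{q^j}{(j+a)^s}$ is the Lerch transcendent (in its domain of convergence), $\zeta$ is the Riemann zeta function, $\beta(s)=\sum_{j\ge0}(-1)^j(2j+1)^{-s}$ is the Dirichlet beta function and $\lambda(s)=\sum_{j\ge0}(2j+1)^{-s}=(1-2^{-s})\zeta(s)$ is the Dirichlet lambda function. $[z^r]F(z)$ denotes the coefficient of $z^r$ in the expansion of $F$ at the origin; $\arcsin z$ is expanded as its Taylor series at $0$ (with $\arcsin 0=0$), and $(1-z^2)^{(m-1)/2}$ as its binomial series at $0$ (value $1$ at $z=0$). *)

(* Defs.v *)
From Stdlib Require Export Reals Factorial.
From Coquelicot Require Export Coquelicot.
Open Scope R_scope.

Definition arctanh (x : R) : R := ln ((1 + x) / (1 - x)) / 2.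

(* All the series below are real-valued and use Coquelicot's total [Series];
   they have their usual meaning only where they converge: real [s], [a > 0]
   for [Lerch_Phi]; [s > 0] for [Dirichlet_beta]; [s > 1] for
   [Dirichlet_lambda] and [Riemann_zeta]. *)
Definition Lerch_Phi (q s a : R) : R :=
  Series (fun j : nat => q ^ j / Rpower (INR j + a) s).

Definition Dirichlet_beta (s : R) : R :=
  Series (fun j : nat => (-1) ^ j / Rpower (2 * INR j + 1) s).

Definition Dirichlet_lambda (s : R) : R :=
  Series (fun j : nat => 1 / Rpower (2 * INR j + 1) s).

Definition Riemann_zeta (s : R) : R :=
  Series (fun j : nat => 1 / Rpower (INR j + 1) s).

(* [z^r] F(z), as the Taylor coefficient of F at 0; meaningful for F smooth
   near 0. *)
Definition coeff_at_0 (r : nat) (F : R -> R) : R :=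
  Derive_n F r 0 / INR (fact r).

(* Main.v *)
Require Import Defs.
From Stdlib Require Import Reals Lra Lia Arith Ratan.
From Coquelicot Require Import Coquelicot.
Open Scope R_scope.

(* Put x = tanh t: the integral becomes that of F_m(t) / t^n over (0, oo), with
   F_m = tanh^m / cosh^(1+e). Since F_m' = m F_(m-1) - (m+1+e) F_(m+1), F_m is a
   combination of derivatives of H = sech (e = 0) or tanh (e = 1), and
   integration by parts in t lowers n to 1. What remains are the integrals of
   H^(r)(t) / t; expanding H in partial fractions over the poles i a_j,
   a_j = pi (j + 1/2), each term has an explicit primitive and the sum of the
   values is a Lerch series. The coefficients of F_m in terms of the H^(k) obey
   the same recurrence as the numbers [z^(m+e)] (1-z^2)^((m-1)/2) arcsin^k z / k!,
   up to sign: differentiate (1-z^2)^(m/2) arcsin^k z. *)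

(** * Dominated convergence of series *)

(** Integration by parts acts on F_m itself, never on a single derivative of H: since F_m = O(t^m)
    and m >= n, the boundary term F_m / t^(n-1) vanishes at 0, while those of the separate H^(k) may
    blow up. F_m is expanded only once the exponent of t is 1, and the coefficients carry the result
    back through the recurrence that the integrals share with them. At exponent 1 there are two
    obstructions: H^(r)(t) / t is singular at 0 when H^(r) is even, and tanh t / t is not integrable
    at infinity. Parity of m + n removes the first kind of term, and tanh itself never occurs in
    F_m. The binomial coefficient is (k+n-1)! / ((n-1)! k!): the numerator comes from
    differentiating a simple pole, (n-1)! from the integrations by parts, k! from arcsin^k z / k!.
    The sech expansion converges only conditionally, so it is obtained from a Fourier argument and
    majorants are used only from the first derivative on. *)

Lemma filterlim_locally_R {T : Type} (F : (T -> Prop) -> Prop) {FF : Filter F}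
  (f : T -> R) (l : R) :
  filterlim f F (locally l) <->
  (forall eps : R, 0 < eps -> F (fun x => Rabs (f x - l) < eps)).
Proof.
  split.
  - intros H eps He.
    exact (proj1 (filterlim_locally f l) H (mkposreal eps He)).
  - intros H. apply (proj2 (filterlim_locally f l)). intros [eps He].
    exact (H eps He).
Qed.

Lemma filterlim_sum_f_R0 {T : Type} (F : (T -> Prop) -> Prop) {FF : Filter F}
  (u : nat -> T -> R) (l : nat -> R) (n : nat) :
  (forall j, filterlim (u j) F (locally (l j))) ->
  filterlim (fun x => sum_f_R0 (fun j => u j x) n) F (locally (sum_f_R0 l n)).
Proof.
  intros H. induction n as [|n IH]; simpl.
  - apply H.
  - apply (filterlim_comp_2 _ _ Rplus IH (H (S n))).
    apply (filterlim_plus (V := R_NormedModule)).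
Qed.

(** The cutoff is chosen before the sequence, hence is uniform over everything dominated by [M];
    this is what lets a limit pass through the series. *)
Lemma Series_dominated_tail (M : nat -> R) :
  ex_series M -> forall eps, 0 < eps -> exists n, (0 < n)%nat /\
  forall a : nat -> R, (forall j, Rabs (a j) <= M j) ->
  Rabs (Series a - sum_f_R0 a (pred n)) < eps.
Proof.
  intros HM eps He.
  assert (HL := proj1 (filterlim_locally_R _ _ _) (Series_correct _ HM) eps He).
  destruct HL as [N HN].
  exists (S N). split. { lia. }
  intros a Ha.
  assert (Habs : ex_series (fun j => Rabs (a j))).
  { apply (@ex_series_le R_AbsRing R_CompleteNormedModule) with M; auto.
    intros j. unfold norm; simpl. unfold abs; simpl. rewrite Rabs_Rabsolu. apply Ha. }
  rewrite (Series_incr_n a (S N)); [|lia|now apply ex_series_Rabs].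
  simpl Init.Nat.pred.
  ring_simplify (sum_f_R0 a N + Series (fun k => a (S N + k)%nat) - sum_f_R0 a N).
  eapply Rle_lt_trans.
  { apply Series_Rabs. apply (ex_series_incr_n (fun j => Rabs (a j)) (S N)). exact Habs. }
  eapply Rle_lt_trans.
  { apply Series_le with (b := fun k => M (S N + k)%nat).
    - intros k. split; [apply Rabs_pos|apply Ha].
    - apply (ex_series_incr_n M (S N)). exact HM. }
  specialize (HN N (le_n _)).
  rewrite (Series_incr_n M (S N)) in HN; [|lia|assumption].
  rewrite sum_n_Reals in HN. simpl Init.Nat.pred in HN.
  apply Rabs_def2 in HN. lra.
Qed.

(** Tannery's theorem for an arbitrary proper filter; it serves both for difference quotients
    (filter [locally' 0]) and for limits at infinity. *)
Lemma filterlim_Series_dominated {T : Type} (F : (T -> Prop) -> Prop)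
  {FF : ProperFilter F} (u : nat -> T -> R) (l M : nat -> R) :
  ex_series M ->
  F (fun x => forall j, Rabs (u j x) <= M j) ->
  (forall j, filterlim (u j) F (locally (l j))) ->
  filterlim (fun x => Series (fun j => u j x)) F (locally (Series l)).
Proof.
  intros HM HF Hl.
  (* The bound passes to the limits: properness of the filter supplies a point where [u j x] is both
     dominated and close to [l j]. *)
  assert (HlM : forall j, Rabs (l j) <= M j).
  { intros j. apply Rnot_lt_le. intros Hlt.
    assert (He : 0 < Rabs (l j) - M j) by lra.
    assert (H1 := proj1 (filterlim_locally_R _ _ _) (Hl j) _ He).
    destruct (filter_ex _ (filter_and _ _ H1 HF)) as [x [Hx1 Hx2]].
    specialize (Hx2 j). simpl in Hx1.
    assert (Rabs (l j) <= Rabs (u j x) + Rabs (u j x - l j)).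
    { replace (l j) with (u j x - (u j x - l j)) at 1 by ring.
      eapply Rle_trans; [apply Rabs_triang|]. rewrite Rabs_Ropp. lra. }
    lra. }
  apply (proj2 (filterlim_locally_R _ _ _)). intros eps He.
  destruct (Series_dominated_tail M HM (eps / 3)) as [n [Hn Htail]]; [lra|].
  assert (Hfin := proj1 (filterlim_locally_R _ _ _)
    (filterlim_sum_f_R0 F u l (pred n) Hl) (eps / 3) ltac:(lra)).
  apply (filter_imp (fun x => (forall j, Rabs (u j x) <= M j) /\
    Rabs (sum_f_R0 (fun j => u j x) (pred n) - sum_f_R0 l (pred n)) < eps / 3)).
  2:{ now apply filter_and. }
  intros x [Hx1 Hx2].
  assert (H1 := Htail _ Hx1). assert (H2 := Htail _ HlM).
  apply Rabs_def2 in H1, H2, Hx2. apply Rabs_def1; lra.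
Qed.

Lemma filterlim_quotient_of_derive (f : R -> R) (x l : R) :
  is_derive f x l <->
  filterlim (fun h => (f (x + h) - f x) / h) (locally' 0) (locally l).
Proof.
  rewrite is_derive_Reals. split.
  - intros H. apply (proj2 (filterlim_locally_R _ _ _)). intros eps He.
    destruct (H eps He) as [d Hd]. exists d. intros h Hh Hh0.
    apply Hd; auto. unfold ball in Hh; simpl in Hh.
    unfold AbsRing_ball, abs, minus, plus, opp in Hh; simpl in Hh.
    now rewrite Ropp_0, Rplus_0_r in Hh.
  - intros H eps He.
    destruct (proj1 (filterlim_locally_R _ _ _) H eps He) as [d Hd]. exists d.
    intros h Hh0 Hh. apply (Hd h); auto.
    unfold ball; simpl. unfold AbsRing_ball, abs, minus, plus, opp; simpl.
    now rewrite Ropp_0, Rplus_0_r.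
Qed.

(* The difference quotients are dominated by [M] thanks to the mean value
   theorem, so the limit may be taken termwise. *)
Lemma is_derive_Series (f df : nat -> R -> R) (M : nat -> R) :
  ex_series M ->
  (forall j x, is_derive (f j) x (df j x)) ->
  (forall j x, Rabs (df j x) <= M j) ->
  (forall x, ex_series (fun j => f j x)) ->
  forall x, is_derive (fun x => Series (fun j => f j x)) x (Series (fun j => df j x)).
Proof.
  intros HM Hd Hb Hex x.
  apply filterlim_quotient_of_derive.
  apply filterlim_ext_loc with
    (fun h => Series (fun j => (f j (x + h) - f j x) / h)).
  { apply filter_forall. intros h. unfold Rdiv.
    rewrite Series_scal_r, Series_minus; auto. }
  apply (@filterlim_Series_dominated R (locally' 0) (Rbar_locally'_filter 0)
    (fun j h => (f j (x + h) - f j x) / h) (fun j => df j x) M HM).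
  2:{ intros j. now apply filterlim_quotient_of_derive. }
  exists (mkposreal 1 Rlt_0_1). intros h _ Hh0 j.
  destruct (MVT_gen (f j) x (x + h) (df j)) as [c [_ Hc]].
  - intros; apply Hd.
  - intros y _. apply derivable_continuous_pt. exists (df j y).
    apply is_derive_Reals, Hd.
  - rewrite Hc. simpl. replace (df j c * (x + h - x) / h) with (df j c); [apply Hb|].
    field. exact Hh0.
Qed.

(** * Partial fractions of sech and tanh *)

Definition half_pole (j : nat) : R := PI * (INR j + 1 / 2).

Lemma half_pole_S j : half_pole (S j) = half_pole j + PI.
Proof. unfold half_pole. rewrite S_INR. ring. Qed.

Lemma half_pole_lb j : 1 <= half_pole j.
Proof.
  unfold half_pole. assert (H := pos_INR j). assert (H1 := PI2_3_2). nra.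
Qed.

Lemma cos_sin_half_pole j :
  cos (half_pole j) = 0 /\ sin (half_pole j) = (-1) ^ j.
Proof.
  induction j as [|j [IHc IHs]].
  - unfold half_pole. simpl INR.
    replace (PI * (0 + 1 / 2)) with (PI / 2) by field.
    rewrite cos_PI2, sin_PI2. split; reflexivity.
  - rewrite half_pole_S, neg_cos, neg_sin, IHc, IHs. simpl. split; ring.
Qed.

(** * Convergence at 0 of half-integer cosine expansions *)

Lemma Rabs_increment_le (f df : R -> R) (a b C : R) :
  a <= b ->
  (forall x, a <= x <= b -> is_derive f x (df x)) ->
  (forall x, a <= x <= b -> Rabs (df x) <= C) ->
  Rabs (f b - f a) <= C * (b - a).
Proof.
  intros Hab Hd Hb.
  assert (E1 := Rmin_left a b Hab). assert (E2 := Rmax_right a b Hab).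
  destruct (MVT_gen f a b df) as [c [Hc1 Hc2]]; rewrite ?E1, ?E2 in *.
  - intros x Hx. apply Hd. lra.
  - intros x Hx. apply derivable_continuous_pt. exists (df x).
    apply is_derive_Reals, Hd, Hx.
  - rewrite Hc2, Rabs_mult, (Rabs_right (b - a)) by lra.
    apply Rmult_le_compat_r; [lra|]. now apply Hb.
Qed.

Definition dirichlet (N : nat) (y : R) : R :=
  sum_f_R0 (fun j => 2 * cos (half_pole j * y)) N.

(** Multiplying each cosine by the sine of half the frequency gap makes the sum telescope. *)
Lemma dirichlet_closed N y :
  sin (PI * y / 2) * dirichlet N y = sin (INR (S N) * PI * y).
Proof.
  assert (Hstep : forall j, sin (PI * y / 2) * (2 * cos (half_pole j * y)) =
    sin (INR (S j) * PI * y) - sin (INR j * PI * y)).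
  { intros j. rewrite S_INR. unfold half_pole.
    replace ((INR j + 1) * PI * y) with (PI * (INR j + 1 / 2) * y + PI * y / 2) by field.
    replace (INR j * PI * y) with (PI * (INR j + 1 / 2) * y - PI * y / 2) by field.
    rewrite sin_plus, sin_minus. ring. }
  unfold dirichlet. induction N as [|N IH].
  - cbn [sum_f_R0]. rewrite Hstep. simpl INR. rewrite !Rmult_0_l, sin_0. ring.
  - cbn [sum_f_R0]. rewrite Rmult_plus_distr_l, IH, Hstep. ring.
Qed.

Lemma sin_half_lb y : 0 <= y <= 1 -> y / 2 <= sin (PI * y / 2).
Proof.
  intros Hy. assert (H1 := PI_4). assert (H2 := PI2_3_2).
  assert (Hx : 0 <= PI * y / 2 <= 2) by nra.
  assert (Hs := proj1 (sin_bound (PI * y / 2) 0 ltac:(lra) ltac:(nra))).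
  unfold sin_approx, sin_term in Hs. simpl in Hs.
  set (x := PI * y / 2) in *.
  (* With [x * x <= 4] the cubic Taylor bound gives [sin x >= x / 3], and [x >= 3 * y / 2] because
     pi exceeds 3. *)
  assert (Hq : x - x * x * x / 6 <= sin x).
  { eapply Rle_trans; [|apply Hs]. right. field. }
  assert (y * 3 / 2 <= x) by (unfold x; nra).
  assert (x * x <= 4) by nra.
  assert (x * x * x <= 4 * x) by nra. lra.
Qed.

Lemma is_lim_seq_inv_sqrt C : is_lim_seq (fun N => C / sqrt (INR (S N))) 0.
Proof.
  replace (Finite 0) with (Rbar_mult C 0) by (simpl; now rewrite Rmult_0_r).
  apply is_lim_seq_scal_l.
  replace (Finite 0) with (Rbar_inv p_infty) by reflexivity.
  apply is_lim_seq_inv; [|discriminate].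
  apply (filterlim_comp _ _ _ (fun N => INR (S N)) sqrt) with (Rbar_locally p_infty).
  - apply (is_lim_seq_incr_1 INR), is_lim_seq_INR.
  - apply filterlim_sqrt_p.
Qed.

(* Away from 0 write [dirichlet N = sin ((N+1) pi y) / sin (pi y / 2)] and
   integrate by parts; near 0 the vanishing of [g] compensates the kernel.
   The two regions are separated at [1 / sqrt (N+1)]. *)
Lemma dirichlet_vanishing_bound (g dg Psi : R -> R) (K : R) (N : nat) :
  g 0 = 0 ->
  (forall y, is_derive g y (dg y)) ->
  (forall y, 0 <= y <= 1 -> Rabs (dg y) <= K) ->
  (forall y, is_derive Psi y (g y * dirichlet N y)) ->
  Rabs (Psi 1 - Psi 0) <= 16 * K / sqrt (INR (S N)).
Proof.
  intros Hg0 Hg HK HPsi.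
  assert (HN : 1 <= INR (S N)) by (rewrite S_INR; assert (H := pos_INR N); lra).
  set (M := INR (S N)) in *. set (r := sqrt M).
  assert (Hr1 : 1 <= r) by (rewrite <- sqrt_1; apply sqrt_le_1; lra).
  assert (HrM : r * r = M) by (apply sqrt_sqrt; lra).
  assert (HK0 : 0 <= K) by (eapply Rle_trans; [apply Rabs_pos|apply (HK 0)]; lra).
  assert (HPI := PI2_3_2). assert (HPI4 := PI_4).
  set (d := / r).
  assert (Hd : 0 < d <= 1).
  { unfold d. split; [apply Rinv_0_lt_compat; lra|].
    rewrite <- Rinv_1. apply Rinv_le_contravar; lra. }
  assert (Hgb : forall y, 0 <= y <= 1 -> Rabs (g y) <= K * y).
  { intros y Hy. rewrite <- (Rminus_0_r (g y)), <- Hg0, <- (Rminus_0_r y) at 1.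
    rewrite Rminus_0_r.
    replace (K * y) with (K * (y - 0)) by ring.
    apply Rabs_increment_le with dg; [lra|auto|]. intros; apply HK; lra. }
  set (s := fun y => sin (PI * y / 2)).
  assert (Hs : forall y, 0 < y <= 1 -> y / 2 <= s y).
  { intros y Hy. apply sin_half_lb. lra. }
  assert (Hq : forall y, 0 < y <= 1 -> Rabs (g y / s y) <= 2 * K).
  { intros y Hy. assert (H1 := Hs y Hy). unfold Rdiv.
    rewrite Rabs_mult, (Rabs_right (/ s y)).
    2:{ apply Rle_ge, Rlt_le, Rinv_0_lt_compat. lra. }
    apply Rmult_le_reg_r with (s y); [lra|].
    rewrite Rmult_assoc, Rinv_l; [|lra]. assert (H2 := Hgb y ltac:(lra)). nra. }
  assert (Hker : forall y, 0 < y <= 1 -> g y * dirichlet N y = g y / s y * sin (M * PI * y)).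
  { intros y Hy. unfold M. rewrite <- dirichlet_closed. fold (s y). field.
    assert (H1 := Hs y Hy). lra. }
  assert (B1 : Rabs (Psi d - Psi 0) <= 2 * K * (d - 0)).
  { apply Rabs_increment_le with (fun y => g y * dirichlet N y); [lra|auto|].
    intros y Hy. destruct (Req_dec y 0) as [->|Hy0].
    - rewrite Hg0, Rmult_0_l, Rabs_R0. lra.
    - rewrite Hker, Rabs_mult; [|lra]. assert (H1 := Hq y ltac:(lra)).
      assert (H2 : Rabs (sin (M * PI * y)) <= 1) by (apply Rabs_le, SIN_bound).
      assert (H3 := Rabs_pos (g y / s y)). assert (H4 := Rabs_pos (sin (M * PI * y))). nra. }
  (* [Phi] is the boundary term of the integration by parts; its derivative differs from
     [g y * dirichlet N y] by a term of size 1 / M, which involves the derivative [dq] of the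
     quotient [g / s]. *)
  set (Phi := fun y => - (g y / s y) * cos (M * PI * y) / (M * PI)).
  set (dq := fun y => (dg y * s y - g y * (PI / 2 * cos (PI * y / 2))) / s y ^ 2).
  assert (B2 : Rabs ((Psi 1 + - Phi 1) - (Psi d + - Phi d)) <= 10 * K / (d * M) * (1 - d)).
  { apply (Rabs_increment_le (fun y => Psi y + - Phi y)
      (fun y => dq y * cos (M * PI * y) / (M * PI))); [lra| |].
    - intros y Hy. assert (H1 := Hs y ltac:(lra)).
      assert (HPhi : is_derive Phi y
        (- dq y * cos (M * PI * y) / (M * PI) + g y / s y * sin (M * PI * y))).
      { unfold Phi, s. auto_derive.
        - repeat split; [now exists (dg y)|]. fold (s y) in *.
          unfold s in H1. lra.
        - change (Derive (fun x => g x) y) with (Derive g y).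
          rewrite (is_derive_unique g y _ (Hg y)). unfold dq, s.
          change (PI * y * / 2) with (PI * y / 2). field.
          unfold s in H1. repeat split; lra. }
      replace (dq y * cos (M * PI * y) / (M * PI)) with
        (g y * dirichlet N y +
         - (- dq y * cos (M * PI * y) / (M * PI) + g y / s y * sin (M * PI * y))).
      2:{ rewrite Hker; [|lra]. field. lra. }
      apply (is_derive_plus (K := R_AbsRing) (V := R_NormedModule)); [apply HPsi|].
      now apply (is_derive_opp (K := R_AbsRing) (V := R_NormedModule)).
    - intros y Hy. assert (H1 := Hs y ltac:(lra)).
      assert (Hdq : Rabs (dq y) <= 10 * K / d).
      { apply Rle_trans with (10 * K / y).
        2:{ apply Rmult_le_compat_l; [lra|]. apply Rinv_le_contravar; lra. }
        unfold dq.
        replace ((dg y * s y - g y * (PI / 2 * cos (PI * y / 2))) / s y ^ 2)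
          with (dg y / s y + - (g y / s y * (PI / 2) * cos (PI * y / 2) / s y))
          by (field; lra).
        assert (Hi : / s y <= 2 / y).
        { replace (2 / y) with (/ (y / 2)) by (field; lra).
          apply Rinv_le_contravar; lra. }
        assert (Hi0 : 0 < / s y) by (apply Rinv_0_lt_compat; lra).
        eapply Rle_trans; [apply Rabs_triang|]. rewrite Rabs_Ropp.
        assert (Hdiv : forall z, Rabs (z / s y) = Rabs z * / s y).
        { intros z. unfold Rdiv. rewrite Rabs_mult, (Rabs_right (/ s y)) by lra.
          reflexivity. }
        rewrite (Hdiv (dg y)), (Hdiv (_ * _)), !Rabs_mult.
        assert (A1 := HK y ltac:(lra)). assert (A2 := Hq y ltac:(lra)).
        assert (A3 : Rabs (cos (PI * y / 2)) <= 1) by (apply Rabs_le, COS_bound).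
        rewrite (Rabs_right (PI / 2)) by lra.
        assert (A4 := Rabs_pos (g y / s y)). assert (A5 := Rabs_pos (cos (PI * y / 2))).
        assert (A6 := Rabs_pos (dg y)).
        assert (A7 : Rabs (g y / s y) * (PI / 2) * Rabs (cos (PI * y / 2)) <= 4 * K).
        { assert (Rabs (g y / s y) * (PI / 2) <= 4 * K) by nra.
          assert (0 <= Rabs (g y / s y) * (PI / 2)) by nra. nra. }
        assert (A8 : 10 * K / y = 5 * K * (2 / y)) by (field; lra). rewrite A8.
        assert (A9 : 0 <= Rabs (g y / s y) * (PI / 2) * Rabs (cos (PI * y / 2))).
        { apply Rmult_le_pos; [nra|lra]. }
        nra. }
      unfold Rdiv at 1. rewrite !Rabs_mult, (Rabs_right (/ (M * PI))).
      2:{ apply Rle_ge, Rlt_le, Rinv_0_lt_compat. nra. }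
      assert (A3 : Rabs (cos (M * PI * y)) <= 1) by (apply Rabs_le, COS_bound).
      assert (A4 := Rabs_pos (dq y)). assert (A5 := Rabs_pos (cos (M * PI * y))).
      replace (10 * K / (d * M)) with (10 * K / d * / M) by (field; lra).
      apply Rmult_le_compat; [nra| |nra|].
      + apply Rlt_le, Rinv_0_lt_compat. nra.
      + apply Rinv_le_contravar; nra. }
  assert (B3 : forall y, 0 < y <= 1 -> Rabs (Phi y) <= 2 * K / M).
  { intros y Hy. unfold Phi. unfold Rdiv at 1.
    rewrite !Rabs_mult, Rabs_Ropp, (Rabs_right (/ (M * PI))).
    2:{ apply Rle_ge, Rlt_le, Rinv_0_lt_compat. nra. }
    assert (A3 : Rabs (cos (M * PI * y)) <= 1) by (apply Rabs_le, COS_bound).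
    assert (A4 := Rabs_pos (g y / s y)). assert (A5 := Rabs_pos (cos (M * PI * y))).
    assert (A6 := Hq y Hy).
    apply Rmult_le_compat; [nra| |nra|].
    + apply Rlt_le, Rinv_0_lt_compat. nra.
    + apply Rinv_le_contravar; nra. }
  assert (C1 := B3 1 ltac:(lra)). assert (C2 := B3 d Hd).
  assert (E1 : / M <= d).
  { unfold d. apply Rinv_le_contravar; nra. }
  assert (E2 : 10 * K / (d * M) = 10 * K * d).
  { rewrite <- HrM. unfold d. field. lra. }
  rewrite E2 in B2.
  assert (E3 : 2 * K / M <= 2 * K * d) by (apply Rmult_le_compat_l; lra).
  replace (16 * K / r) with (16 * K * d) by reflexivity.
  assert (E4 : 10 * K * d * (1 - d) <= 10 * K * d).
  { assert (0 <= K * d) by nra. nra. }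
  (* The constant is 2 from [0, d], 10 from [d, 1] and 2 from each of the two boundary values, all
     times [K * d]. *)
  replace (Psi 1 - Psi 0) with ((Psi d - Psi 0) +
    ((Psi 1 + - Phi 1) - (Psi d + - Phi d)) + Phi 1 - Phi d) by ring.
  apply Rabs_le_between in B1, B2, C1, C2. apply Rabs_le_between. lra.
Qed.

(** Leibniz's series for pi / 4, since [2 / half_pole j] is (4 / pi) / (2 j + 1). It is the cosine
    expansion of the constant 1 read at 0. *)
Lemma is_series_inv_half_pole :
  is_series (fun j => (-1) ^ j * (2 / half_pole j)) 1.
Proof.
  assert (H := Alt_PI_eq). unfold Alt_PI in H.
  destruct exist_PI as [l Hl].
  apply is_series_Reals.
  assert (HP := PI_RGT_0).
  replace 1 with (4 / PI * l).
  2:{ replace (4 / PI * l) with (4 * l / PI) by (field; lra). rewrite H. field. lra. }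
  apply Un_cv_ext with (fun N => 4 / PI * sum_f_R0 (tg_alt PI_tg) N).
  { intros N. rewrite scal_sum. apply sum_eq. intros j _.
    unfold tg_alt, PI_tg, half_pole. rewrite plus_INR, mult_INR. simpl (INR 2). simpl (INR 1).
    assert (H1 := PI_RGT_0). assert (H2 := pos_INR j). field. lra. }
  apply (CV_mult (fun _ => 4 / PI)); [|exact Hl].
  intros eps He. exists O. intros. unfold Rdist. rewrite Rminus_diag, Rabs_R0. exact He.
Qed.

Lemma is_derive_sum_f_R0 (f df : nat -> R -> R) (N : nat) (x : R) :
  (forall j, is_derive (f j) x (df j x)) ->
  is_derive (fun x => sum_f_R0 (fun j => f j x) N) x (sum_f_R0 (fun j => df j x) N).
Proof.
  intros H. induction N as [|N IH]; simpl; [apply H|].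
  now apply (is_derive_plus (K := R_AbsRing) (V := R_NormedModule)).
Qed.

Lemma dirichlet_limit (f df : R -> R) (K : R) (Q : nat -> R -> R) :
  (forall y, is_derive f y (df y)) ->
  (forall y, 0 <= y <= 1 -> Rabs (df y) <= K) ->
  (forall j y, is_derive (Q j) y (f y * (2 * cos (half_pole j * y)))) ->
  is_series (fun j => Q j 1 - Q j 0) (f 0).
Proof.
  intros Hf HK HQ.
  set (Q0 := fun j y => f 0 * (2 / half_pole j * sin (half_pole j * y))).
  assert (HQ0 : forall j y, is_derive (Q0 j) y (f 0 * (2 * cos (half_pole j * y)))).
  { intros j y. unfold Q0. auto_derive; [trivial|].
    field. assert (H := half_pole_lb j). lra. }
  assert (HS0 : is_series (fun j => Q0 j 1 - Q0 j 0) (f 0)).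
  { assert (H := is_series_scal_l (f 0) _ _ is_series_inv_half_pole).
    unfold scal in H; simpl in H; unfold mult in H; simpl in H. rewrite Rmult_1_r in H.
    refine (is_series_ext _ _ _ _ H). intros j. simpl. unfold Q0.
    rewrite Rmult_0_r, Rmult_1_r, sin_0, (proj2 (cos_sin_half_pole j)). ring. }
  assert (HSd : is_series (fun j => (Q j 1 - Q j 0) - (Q0 j 1 - Q0 j 0)) 0).
  { change (is_lim_seq (sum_n (fun j => (Q j 1 - Q j 0) - (Q0 j 1 - Q0 j 0))) 0).
    apply (is_lim_seq_le_le_loc (fun N => - (16 * K / sqrt (INR (S N))))) with
      (w := fun N => 16 * K / sqrt (INR (S N))).
    - exists O. intros N _. apply Rabs_le_between. rewrite sum_n_Reals.
      replace (sum_f_R0 _ N) with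
        (sum_f_R0 (fun j => Q j 1 + - Q0 j 1) N - sum_f_R0 (fun j => Q j 0 + - Q0 j 0) N).
      2:{ rewrite <- minus_sum. apply sum_eq. intros; ring. }
      apply (dirichlet_vanishing_bound (fun y => f y - f 0) df
        (fun y => sum_f_R0 (fun j => Q j y + - Q0 j y) N)); auto.
      + ring.
      + intros y. rewrite <- (Rminus_0_r (df y)).
        apply (is_derive_minus (K := R_AbsRing) (V := R_NormedModule)); [auto|].
        apply (is_derive_const (K := R_AbsRing) (V := R_NormedModule)).
      + intros y. unfold dirichlet. rewrite scal_sum.
        apply is_derive_sum_f_R0 with
          (df := fun j y => 2 * cos (half_pole j * y) * (f y - f 0)).
        intros j.
        replace (2 * cos (half_pole j * y) * (f y - f 0)) with
          (f y * (2 * cos (half_pole j * y)) + - (f 0 * (2 * cos (half_pole j * y)))) by ring.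
        apply (is_derive_plus (K := R_AbsRing) (V := R_NormedModule)); [auto|].
        apply (is_derive_opp (K := R_AbsRing) (V := R_NormedModule)); auto.
    - replace (Finite 0) with (Rbar_opp 0) by (simpl; now rewrite Ropp_0).
      apply -> is_lim_seq_opp. apply (is_lim_seq_inv_sqrt (16 * K)).
    - apply (is_lim_seq_inv_sqrt (16 * K)). }
  rewrite <- (Rplus_0_l (f 0)).
  apply is_series_ext with (fun j => plus ((Q j 1 - Q j 0) - (Q0 j 1 - Q0 j 0)) (Q0 j 1 - Q0 j 0)).
  { intros j. unfold plus; simpl. ring. }
  now apply (is_series_plus (K := R_AbsRing) (V := R_NormedModule)).
Qed.

Lemma cosh_pos t : 0 < cosh t.
Proof. unfold cosh. assert (H := exp_pos t). assert (H1 := exp_pos (- t)). lra. Qed.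

Lemma cosh_sqr_minus_sinh_sqr t : cosh t * cosh t - sinh t * sinh t = 1.
Proof.
  unfold cosh, sinh. assert (H := exp_plus t (- t)).
  rewrite Rplus_opp_r, exp_0 in H. lra.
Qed.

Lemma exp_incr_le x y : x <= y -> exp x <= exp y.
Proof. intros [H| ->]; [now apply Rlt_le, exp_increasing|apply Rle_refl]. Qed.

Lemma cosh_sinh_bound t x : Rabs x <= Rabs t ->
  Rabs (cosh x) <= exp (Rabs t) /\ Rabs (sinh x) <= exp (Rabs t).
Proof.
  intros H. unfold cosh, sinh.
  assert (Hx : - Rabs t <= x <= Rabs t) by now apply Rabs_le_between.
  assert (H1 : exp x <= exp (Rabs t)) by (apply exp_incr_le; lra).
  assert (H2 : exp (- x) <= exp (Rabs t)) by (apply exp_incr_le; lra).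
  assert (H3 := exp_pos x). assert (H4 := exp_pos (- x)).
  split; apply Rabs_le; lra.
Qed.

(* Fourier expansion of [y |-> cosh (t y)] on [0, 1], read at [y = 0]. *)
Lemma is_series_sech t :
  is_series (fun j => (-1) ^ j * (2 * half_pole j / (t ^ 2 + half_pole j ^ 2))) (/ cosh t).
Proof.
  assert (HH : forall j, 0 < t ^ 2 + half_pole j ^ 2).
  { intros j. assert (H := half_pole_lb j). nra. }
  assert (Hc := cosh_pos t).
  assert (H : is_series (fun j =>
    (fun y => 2 * (t * sinh (t * y) * cos (half_pole j * y) +
       half_pole j * cosh (t * y) * sin (half_pole j * y)) / (t ^ 2 + half_pole j ^ 2)) 1 -
    (fun y => 2 * (t * sinh (t * y) * cos (half_pole j * y) +
       half_pole j * cosh (t * y) * sin (half_pole j * y)) / (t ^ 2 + half_pole j ^ 2)) 0)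
    (cosh (t * 0))).
  { apply (dirichlet_limit (fun y => cosh (t * y)) (fun y => t * sinh (t * y))
      (Rabs t * exp (Rabs t)) (fun j y => 2 * (t * sinh (t * y) * cos (half_pole j * y) +
       half_pole j * cosh (t * y) * sin (half_pole j * y)) / (t ^ 2 + half_pole j ^ 2))).
    - intros y. unfold cosh, sinh. auto_derive; [trivial|]. field.
    - intros y Hy. rewrite Rabs_mult. apply Rmult_le_compat_l; [apply Rabs_pos|].
      apply cosh_sinh_bound. rewrite Rabs_mult, (Rabs_right y) by lra.
      assert (H := Rabs_pos t). nra.
    - intros j y. unfold cosh, sinh. assert (H := HH j). auto_derive; [trivial|].
      field. lra. }
  rewrite Rmult_0_r, cosh_0 in H.
  replace (/ cosh t) with (scal (/ cosh t) 1) by apply Rmult_1_r.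
  refine (is_series_ext _ _ _ _ (is_series_scal_l (/ cosh t) _ _ H)).
  intros j. unfold scal; simpl; unfold mult; simpl.
  destruct (cos_sin_half_pole j) as [Ec Es].
  rewrite !Rmult_1_r, !Rmult_0_r, Ec, Es, sinh_0, sin_0.
  assert (Hj := HH j). field. simpl in Hj. lra.
Qed.

(* Fourier expansion of [y |-> sinh (t (1 - y))] on [0, 1], read at [y = 0]. *)
Lemma is_series_tanh t :
  is_series (fun j => 2 * t / (t ^ 2 + half_pole j ^ 2)) (tanh t).
Proof.
  assert (HH : forall j, 0 < t ^ 2 + half_pole j ^ 2).
  { intros j. assert (H := half_pole_lb j). nra. }
  assert (Hc := cosh_pos t).
  assert (H := dirichlet_limit (fun y => sinh (t * (1 - y)))
     (fun y => - (t * cosh (t * (1 - y)))) (Rabs t * exp (Rabs t))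
     (fun j y => 2 * (- t * cosh (t * (1 - y)) * cos (half_pole j * y) +
       half_pole j * sinh (t * (1 - y)) * sin (half_pole j * y)) / (t ^ 2 + half_pole j ^ 2))).
  cbv beta in H. rewrite Rminus_0_r, Rmult_1_r in H.
  replace (tanh t) with (scal (/ cosh t) (sinh t)) by apply Rmult_comm.
  refine (is_series_ext _ _ _ _ (is_series_scal_l (/ cosh t) _ _ (H _ _ _))).
  - intros j. unfold scal; simpl; unfold mult; simpl.
    destruct (cos_sin_half_pole j) as [Ec Es].
    rewrite Rminus_diag, !Rmult_1_r, !Rmult_0_r, Ec, Es, sinh_0, sin_0, cos_0.
    assert (Hj := HH j). field. simpl in Hj. lra.
  - intros y. unfold cosh, sinh, Rminus. auto_derive; [trivial|]. field.
  - intros y Hy. rewrite Rabs_Ropp, Rabs_mult. apply Rmult_le_compat_l; [apply Rabs_pos|].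
    apply cosh_sinh_bound. rewrite Rabs_mult, (Rabs_right (1 - y)) by lra.
    assert (H0 := Rabs_pos t). nra.
  - intros j y. unfold cosh, sinh, Rminus. assert (Hj := HH j). auto_derive; [trivial|].
    field. lra.
Qed.

(** * Powers of 1 / (1 - iu) *)

(* [w_pow k u] is the pair of real and imaginary parts of (1 - iu)^(-k). *)
Fixpoint w_pow (k : nat) (u : R) : R * R :=
  match k with
  | O => (1, 0)
  | S k => let (p, o) := w_pow k u in
           ((p - u * o) / (1 + u ^ 2), (o + u * p) / (1 + u ^ 2))
  end.

Definition w_re (k : nat) (u : R) : R := fst (w_pow k u).
Definition w_im (k : nat) (u : R) : R := snd (w_pow k u).

Lemma w_re_S k u : w_re (S k) u = (w_re k u - u * w_im k u) / (1 + u ^ 2).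
Proof. unfold w_re, w_im. simpl. now destruct (w_pow k u). Qed.

Lemma w_im_S k u : w_im (S k) u = (w_im k u + u * w_re k u) / (1 + u ^ 2).
Proof. unfold w_re, w_im. simpl. now destruct (w_pow k u). Qed.

Lemma one_plus_sqr_pos u : 0 < 1 + u ^ 2.
Proof. nra. Qed.

(** Imaginary part of w^(k+1) (1 - iu) = w^k. Being free of denominators, it shows by induction that
    [w_im k u] is divisible by u. *)
Lemma w_im_rec k u : w_im (S k) u = w_im k u + u * w_re (S k) u.
Proof. rewrite w_re_S, w_im_S. assert (H := one_plus_sqr_pos u). field. lra. Qed.

(** Real and imaginary parts of (w^k)' = i k w^(k+1), where w = 1 / (1 - iu). *)
Lemma is_derive_w k u :
  is_derive (w_re k) u (- INR k * w_im (S k) u) /\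
  is_derive (w_im k) u (INR k * w_re (S k) u).
Proof.
  induction k as [|k [IHr IHi]].
  - split; [apply is_derive_ext with (fun _ => 1)|apply is_derive_ext with (fun _ => 0)];
    try reflexivity; simpl INR; [rewrite Ropp_0|]; rewrite Rmult_0_l;
    apply (@is_derive_const R_AbsRing R_NormedModule).
  - assert (Hp := one_plus_sqr_pos u).
    assert (Er : Derive (w_re k) u = - INR k * w_im (S k) u) by now apply is_derive_unique.
    assert (Ei : Derive (w_im k) u = INR k * w_re (S k) u) by now apply is_derive_unique.
    split.
    + apply is_derive_ext with (fun u => (w_re k u - u * w_im k u) / (1 + u ^ 2)).
      { intros; now rewrite w_re_S. }
      auto_derive.
      { repeat split; auto; try (eexists; eassumption). simpl in Hp |- *; lra. }
      change (Derive (fun x => w_re k x) u) with (Derive (w_re k) u).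
      change (Derive (fun x => w_im k x) u) with (Derive (w_im k) u).
      rewrite Er, Ei, S_INR, !w_im_S, !w_re_S, ?w_im_S. field. simpl in Hp |- *; lra.
    + apply is_derive_ext with (fun u => (w_im k u + u * w_re k u) / (1 + u ^ 2)).
      { intros; now rewrite w_im_S. }
      auto_derive.
      { repeat split; auto; try (eexists; eassumption). simpl in Hp |- *; lra. }
      change (Derive (fun x => w_re k x) u) with (Derive (w_re k) u).
      change (Derive (fun x => w_im k x) u) with (Derive (w_im k) u).
      rewrite Er, Ei, S_INR, !w_re_S, !w_im_S, ?w_re_S. field. simpl in Hp |- *; lra.
Qed.

Lemma w_norm_sqr k u : w_re k u ^ 2 + w_im k u ^ 2 = / (1 + u ^ 2) ^ k.
Proof.
  assert (Hp := one_plus_sqr_pos u).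
  induction k as [|k IH].
  - unfold w_re, w_im; simpl. field.
  - rewrite w_re_S, w_im_S.
    replace (((w_re k u - u * w_im k u) / (1 + u ^ 2)) ^ 2 +
      ((w_im k u + u * w_re k u) / (1 + u ^ 2)) ^ 2) with
      ((w_re k u ^ 2 + w_im k u ^ 2) / (1 + u ^ 2)) by (field; lra).
    rewrite IH. change ((1 + u ^ 2) ^ S k) with ((1 + u ^ 2) * (1 + u ^ 2) ^ k).
    field. split; [apply pow_nonzero|]; lra.
Qed.

Lemma w_bound k u :
  Rabs (w_re k u) <= 1 /\ Rabs (w_im k u) <= 1.
Proof.
  assert (H := w_norm_sqr k u).
  assert (H1 : / (1 + u ^ 2) ^ k <= 1).
  { rewrite <- Rinv_1. apply Rinv_le_contravar; [lra|]. apply pow_R1_Rle. nra. }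
  split; apply Rabs_le; nra.
Qed.

(* For u > 0 and k > 0, |w^k| <= |w| <= 1/u. *)
Lemma w_im_bound_inv k u : 0 < u -> Rabs (w_im (S k) u) <= / u.
Proof.
  intros Hu. assert (H := w_norm_sqr (S k) u).
  assert (H1 : / (1 + u ^ 2) ^ S k <= / u ^ 2).
  { apply Rinv_le_contravar; [nra|]. simpl pow.
    assert (1 <= (1 + u ^ 2) ^ k) by (apply pow_R1_Rle; nra). simpl in H0. nra. }
  assert (0 < / u) by now apply Rinv_0_lt_compat.
  rewrite <- (Rabs_right (/ u)) by lra. apply Rsqr_le_abs_0. rewrite !Rsqr_pow2.
  assert (0 <= w_re (S k) u ^ 2) by apply pow2_ge_0. rewrite pow_inv. lra.
Qed.

(* Since [u w^(k+1) = i (w^k - w^(k+1))], the quotient [w_im k u / u] is the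
   polynomial expression below, and [w_im_prim] is its primitive. *)
Fixpoint w_im_quot (k : nat) (u : R) : R :=
  match k with
  | O => 0
  | S k => w_im_quot k u + w_re (S k) u
  end.

Lemma w_im_quot_correct k u : w_im k u = u * w_im_quot k u.
Proof.
  induction k as [|k IH].
  - unfold w_im. simpl. ring.
  - rewrite w_im_rec, IH. simpl. ring.
Qed.

Lemma w_im_quot_bound k u : Rabs (w_im_quot k u) <= INR k.
Proof.
  induction k as [|k IH].
  - simpl. rewrite Rabs_R0. lra.
  - rewrite S_INR. simpl w_im_quot. eapply Rle_trans; [apply Rabs_triang|].
    destruct (w_bound (S k) u). lra.
Qed.

Fixpoint w_im_prim (k : nat) (u : R) : R :=
  match k with
  | O => atan u
  | S k => w_im_prim k u + w_im (S k) u / INR (S k)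
  end.

(** The index is shifted because [w_im_quot 0] is 0: the chain starts at [w_im_quot 1], which is 1 /
    (1 + u^2), and every later summand [w_re (k+2)] integrates to [w_im (k+1) / (k+1)]. *)
Lemma is_derive_w_im_prim k u : is_derive (w_im_prim k) u (w_im_quot (S k) u).
Proof.
  induction k as [|k IH].
  - simpl w_im_quot. rewrite w_re_S. unfold w_re, w_im. simpl.
    replace (0 + (1 - u * 0) / (1 + u * (u * 1))) with (/ (1 + u²)).
    + apply is_derive_atan.
    + unfold Rsqr. field. nra.
  - change (w_im_quot (S (S k)) u) with (w_im_quot (S k) u + w_re (S (S k)) u).
    change (w_im_prim (S k)) with (fun u => w_im_prim k u + w_im (S k) u / INR (S k)).
    apply (is_derive_plus (K := R_AbsRing) (V := R_NormedModule) _ _ _ _ _ IH).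
    replace (w_re (S (S k)) u) with (INR (S k) * w_re (S (S k)) u / INR (S k))
      by (field; apply not_0_INR; lia).
    apply (is_derive_ext (fun v => / INR (S k) * w_im (S k) v)).
    { intros t. apply Rmult_comm. }
    unfold Rdiv. rewrite Rmult_comm.
    apply (is_derive_scal (w_im (S k)) u (/ INR (S k)) _ (proj2 (is_derive_w (S k) u))).
Qed.

Lemma w_im_prim_0 k : w_im_prim k 0 = 0.
Proof.
  induction k as [|k IH].
  - apply atan_0.
  - simpl w_im_prim. rewrite IH, w_im_quot_correct. unfold Rdiv. ring.
Qed.

Lemma w_im_prim_bound k u : Rabs (w_im_prim k u) <= 2 + INR k.
Proof.
  induction k as [|k IH].
  - simpl. assert (H := atan_bound u). assert (H1 := PI_4). apply Rabs_le. lra.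
  - rewrite S_INR. simpl w_im_prim. eapply Rle_trans; [apply Rabs_triang|].
    assert (Rabs (w_im (S k) u / INR (S k)) <= 1); [|simpl INR in *; lra].
    assert (1 <= INR (S k)) by (rewrite S_INR; assert (H := pos_INR k); lra).
    unfold Rdiv. rewrite Rabs_mult, (Rabs_right (/ _)).
    2:{ apply Rle_ge, Rlt_le, Rinv_0_lt_compat. lra. }
    apply Rmult_le_reg_r with (INR (S k)); [lra|].
    rewrite Rmult_assoc, Rinv_l; [|lra]. destruct (w_bound (S k) u). lra.
Qed.

Lemma filterlim_atan : filterlim atan (Rbar_locally p_infty) (locally (PI / 2)).
Proof.
  apply (proj2 (filterlim_locally_R _ _ _)). intros eps He.
  assert (HP := PI_RGT_0).
  pose (d := Rmin eps (PI / 2)). assert (Hd1 : d <= eps) by apply Rmin_l.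
  assert (Hd2 : d <= PI / 2) by apply Rmin_r.
  assert (Hd : 0 < d) by (apply Rmin_glb_lt; lra).
  exists (tan (PI / 2 - d)). intros x Hx.
  assert (H := atan_increasing _ _ Hx). rewrite atan_tan in H; [|lra].
  assert (Hb := atan_bound x). apply Rabs_def1; lra.
Qed.

Lemma filterlim_inv_infty_bounded (f : R -> R) (C : R) :
  (forall u, 0 < u -> Rabs (f u) <= C * / u) ->
  filterlim f (Rbar_locally p_infty) (locally 0).
Proof.
  intros H. apply (proj2 (filterlim_locally_R _ _ _)). intros eps He.
  exists (Rmax 1 (C / eps)). intros x Hx.
  assert (H1 := Rmax_l 1 (C / eps)). assert (H2 := Rmax_r 1 (C / eps)).
  rewrite Rminus_0_r. eapply Rle_lt_trans; [apply H; lra|].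
  apply Rmult_lt_reg_r with x; [lra|]. rewrite Rmult_assoc, Rinv_l; [|lra].
  assert (C / eps < x) by lra. apply (Rmult_lt_compat_l eps) in H0; [|lra].
  replace (eps * (C / eps)) with C in H0 by (field; lra). lra.
Qed.

(** Only the arctangent survives at infinity; the terms added to it are O(1/u), so the limit does
    not depend on [k]. *)
Lemma filterlim_w_im_prim k :
  filterlim (w_im_prim k) (Rbar_locally p_infty) (locally (PI / 2)).
Proof.
  induction k as [|k IH].
  - apply filterlim_atan.
  - replace (PI / 2) with (PI / 2 + 0 * / INR (S k)) by ring.
    change (w_im_prim (S k)) with (fun u => w_im_prim k u + w_im (S k) u * / INR (S k)).
    assert (Hq : filterlim (fun u => w_im (S k) u * / INR (S k)) (Rbar_locally p_infty)
      (locally (0 * / INR (S k)))).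
    { apply filterlim_comp with (g := fun x => x * / INR (S k)) (G := locally 0).
      - apply filterlim_inv_infty_bounded with 1. intros u Hu.
        rewrite Rmult_1_l. now apply w_im_bound_inv.
      - apply (filterlim_scal_l (K := R_AbsRing) (V := R_NormedModule)). }
    apply (filterlim_comp_2 _ _ Rplus IH Hq).
    apply (filterlim_plus (V := R_NormedModule)).
Qed.

(* [rot s x y] is the imaginary part of i^s (x + iy). *)
Fixpoint rot (s : nat) (x y : R) : R :=
  match s with
  | O => y
  | S s => rot s (- y) x
  end.

(** For even powers of i only the imaginary part of w^k remains. It is odd in u, which is why the
    corresponding partial fractions can be divided by t. *)
Lemma rot_double p x y : rot (2 * p) x y = (-1) ^ p * y.
Proof.
  revert x y; induction p as [|p IH]; intros x y.
  - simpl. ring.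
  - replace (2 * S p)%nat with (S (S (2 * p))) by lia.
    simpl rot. rewrite IH. simpl. ring.
Qed.

Lemma rot_scal s a x y : rot s (a * x) (a * y) = a * rot s x y.
Proof.
  revert x y; induction s as [|s IH]; intros x y; simpl.
  - reflexivity.
  - rewrite <- IH. f_equal. ring.
Qed.

Lemma rot_bound s x y : Rabs x <= 1 -> Rabs y <= 1 -> Rabs (rot s x y) <= 1.
Proof.
  revert x y; induction s as [|s IH]; intros x y Hx Hy; simpl.
  - exact Hy.
  - apply IH; [now rewrite Rabs_Ropp|exact Hx].
Qed.

Lemma is_derive_rot s (f g : R -> R) x df dg :
  is_derive f x df -> is_derive g x dg ->
  is_derive (fun x => rot s (f x) (g x)) x (rot s df dg).
Proof.
  revert f g df dg; induction s as [|s IH]; intros f g df dg Hf Hg; simpl.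
  - exact Hg.
  - apply (IH (fun x => - g x) f); [|exact Hf].
    now apply (is_derive_opp (K := R_AbsRing) (V := R_NormedModule)).
Qed.

Lemma is_derive_rot_w s k u :
  is_derive (fun u => rot s (w_re k u) (w_im k u)) u
    (INR k * rot (S s) (w_re (S k) u) (w_im (S k) u)).
Proof.
  destruct (is_derive_w k u) as [Hr Hi].
  assert (H := is_derive_rot s _ _ _ _ _ Hr Hi). simpl rot.
  rewrite <- rot_scal.
  now replace (INR k * - w_im (S k) u) with (- INR k * w_im (S k) u) by ring.
Qed.

(** * Derivatives of sech and tanh *)

(** A telescoping majorant for the sum of inverse squares. *)
Lemma is_series_telescope :
  is_series (fun j => / (INR j + 1) - / (INR j + 2)) 1.
Proof.
  change (is_lim_seq (sum_n (fun j => / (INR j + 1) - / (INR j + 2))) 1).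
  apply is_lim_seq_ext with (fun n => 1 - / (INR n + 2)).
  { intros n. rewrite sum_n_Reals. induction n as [|n IH].
    - simpl. field.
    - cbn [sum_f_R0]. rewrite <- IH, S_INR. assert (H := pos_INR n). field. lra. }
  replace (Finite 1) with (Finite (1 - 0)) by (f_equal; ring).
  apply is_lim_seq_minus'; [apply is_lim_seq_const|].
  replace (Finite 0) with (Rbar_inv p_infty) by reflexivity.
  apply is_lim_seq_inv; [|discriminate].
  apply is_lim_seq_plus with p_infty 2; [apply is_lim_seq_INR|apply is_lim_seq_const|].
  reflexivity.
Qed.

Lemma ex_series_inv_half_pole_sqr : ex_series (fun j => / half_pole j ^ 2).
Proof.
  apply (@ex_series_le R_AbsRing R_CompleteNormedModule) with
    (fun j => 2 * (/ (INR j + 1) - / (INR j + 2))).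
  - intros j. unfold norm; simpl; unfold abs; simpl. rewrite Rmult_1_r.
    assert (H := half_pole_lb j). assert (Hj := pos_INR j).
    rewrite Rabs_right by (apply Rle_ge, Rlt_le, Rinv_0_lt_compat; nra).
    replace (2 * (/ (INR j + 1) - / (INR j + 2))) with (/ ((INR j + 1) * (INR j + 2) / 2))
      by (field; lra).
    apply Rinv_le_contravar; [nra|].
    assert (HP := PI2_3_2).
    assert (3 * (INR j + 1 / 2) <= half_pole j) by (unfold half_pole; nra). nra.
  - eexists. apply (is_series_scal_l (V := R_NormedModule) 2), is_series_telescope.
Qed.

Lemma inv_half_pole_pow_le k j : 0 < / half_pole j ^ (2 + k) <= / half_pole j ^ 2.
Proof.
  assert (H := half_pole_lb j). split.
  - apply Rinv_0_lt_compat, pow_lt. lra.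
  - apply Rinv_le_contravar; [apply pow_lt; lra|]. apply Rle_pow; [exact H|lia].
Qed.

Lemma sign_pow_bound e j : e = 0%nat \/ e = 1%nat -> Rabs ((2 * INR e - 1) ^ j) = 1.
Proof.
  intros [-> | ->]; simpl INR.
  - replace (2 * 0 - 1) with (-1) by ring. apply pow_1_abs.
  - replace (2 * 1 - 1) with 1 by ring. rewrite pow1. apply Rabs_R1.
Qed.

(* The k-th derivative of sech (e = 0) or tanh (e = 1), as the termwise
   derivative of its partial fraction expansion. *)
Definition pf_term (e k j : nat) (t : R) : R :=
  (2 * INR e - 1) ^ j * (2 * INR (fact k) / half_pole j ^ (S k)) *
  rot (S k - e) (w_re (S k) (t / half_pole j)) (w_im (S k) (t / half_pole j)).

Definition pf_series (e k : nat) (t : R) : R := Series (fun j => pf_term e k j t).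

Lemma is_derive_rescale (f : R -> R) (a b t l : R) :
  is_derive f (t / a) l -> is_derive (fun t => b * f (t / a)) t (b / a * l).
Proof.
  intros H. replace (b / a * l) with (b * (/ a * l)) by (unfold Rdiv; ring).
  apply (is_derive_scal (fun t => f (t / a)) t b).
  apply (is_derive_comp (K := R_AbsRing) (V := R_NormedModule) f (fun t => t / a)); auto.
  auto_derive; [trivial|ring].
Qed.

(** One derivative in t brings the factor i (k+1) / [half_pole j] and raises the power of w by one:
    i goes into [rot], k + 1 into the factorial. *)
Lemma is_derive_pf_term e k j t : e = 0%nat \/ e = 1%nat ->
  is_derive (pf_term e k j) t (pf_term e (S k) j t).
Proof.
  intros He. unfold pf_term.
  assert (H := half_pole_lb j).
  replace (S (S k) - e)%nat with (S (S k - e)) by lia.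
  replace ((2 * INR e - 1) ^ j * (2 * INR (fact (S k)) / half_pole j ^ S (S k)) *
     rot (S (S k - e)) (w_re (S (S k)) (t / half_pole j)) (w_im (S (S k)) (t / half_pole j)))
  with ((2 * INR e - 1) ^ j * (2 * INR (fact k) / half_pole j ^ (S k)) / half_pole j *
    (INR (S k) * rot (S (S k - e)) (w_re (S (S k)) (t / half_pole j))
       (w_im (S (S k)) (t / half_pole j)))).
  - apply (is_derive_rescale (fun u => rot (S k - e) (w_re (S k) u) (w_im (S k) u))).
    apply is_derive_rot_w.
  - rewrite fact_simpl, mult_INR.
    change (half_pole j ^ S (S k)) with (half_pole j * half_pole j ^ S k).
    field. split; [apply pow_nonzero|]; lra.
Qed.

(** The order is [S k] because terms of order 0 are only bounded by a multiple of 1 / [half_pole j],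
    uniformly in t, which is not summable. *)
Lemma pf_term_bound e k j t : e = 0%nat \/ e = 1%nat ->
  Rabs (pf_term e (S k) j t) <= 2 * INR (fact (S k)) * / half_pole j ^ 2.
Proof.
  intros He. unfold pf_term. rewrite !Rabs_mult, sign_pow_bound, Rmult_1_l by exact He.
  assert (Hw := w_bound (S (S k)) (t / half_pole j)).
  assert (Hr := rot_bound (S (S k) - e) _ _ (proj1 Hw) (proj2 Hw)).
  assert (Hp := inv_half_pole_pow_le k j). assert (Hf := INR_fact_lt_0 (S k)).
  unfold Rdiv at 1. change (S (S k)) with (2 + k)%nat in *.
  rewrite Rabs_right by (apply Rle_ge, Rmult_le_pos; lra).
  assert (H0 := Rabs_pos (rot (2 + k - e) (w_re (2 + k) (t / half_pole j))
     (w_im (2 + k) (t / half_pole j)))).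
  rewrite <- (Rmult_1_r (2 * INR (fact (S k)) * / half_pole j ^ 2)).
  apply Rmult_le_compat; try lra.
  - apply Rmult_le_pos; lra.
  - apply Rmult_le_compat_l; lra.
Qed.

(** With w taken at t / a_j, sech uses (2 / a_j) Re w = (2 / a_j) Im (i w) and tanh uses (2 / a_j)
    Im w; hence the initial rotation [1 - e]. *)
Lemma pf_term_0 j t :
  pf_term 0 0 j t = (-1) ^ j * (2 * half_pole j / (t ^ 2 + half_pole j ^ 2)) /\
  pf_term 1 0 j t = 2 * t / (t ^ 2 + half_pole j ^ 2).
Proof.
  unfold pf_term. rewrite w_re_S, w_im_S. unfold w_re, w_im. simpl.
  replace (2 * 0 - 1) with (-1) by ring. replace (2 * 1 - 1) with 1 by ring.
  rewrite pow1. assert (H := half_pole_lb j).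
  split; field; nra.
Qed.

Lemma pf_series_0 t : is_series (fun j => pf_term 0 0 j t) (/ cosh t) /\
  is_series (fun j => pf_term 1 0 j t) (tanh t).
Proof.
  split.
  - refine (is_series_ext _ _ _ _ (is_series_sech t)). intros j.
    symmetry. apply pf_term_0.
  - refine (is_series_ext _ _ _ _ (is_series_tanh t)). intros j.
    symmetry. apply pf_term_0.
Qed.

Lemma ex_series_bounded_by_inv_sqr (a : nat -> R) (C : R) :
  (forall j, Rabs (a j) <= C * / half_pole j ^ 2) -> ex_series a.
Proof.
  intros H. apply (@ex_series_le R_AbsRing R_CompleteNormedModule) with
    (fun j => C * / half_pole j ^ 2); [exact H|].
  apply (ex_series_scal_l (V := R_NormedModule) C), ex_series_inv_half_pole_sqr.
Qed.

Lemma ex_series_pf_term e k t : e = 0%nat \/ e = 1%nat ->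
  ex_series (fun j => pf_term e k j t).
Proof.
  intros He. destruct k as [|k].
  - destruct He as [-> | ->]; eexists; apply pf_series_0.
  - apply ex_series_bounded_by_inv_sqr with (2 * INR (fact (S k))).
    intros j. now apply pf_term_bound.
Qed.

(** Domination is asked of the differentiated series only, so the conditionally convergent case
    [k = 0] is included. *)
Lemma is_derive_pf_series e k t : e = 0%nat \/ e = 1%nat ->
  is_derive (pf_series e k) t (pf_series e (S k) t).
Proof.
  intros He. unfold pf_series.
  apply is_derive_Series with (fun j => 2 * INR (fact (S k)) * / half_pole j ^ 2).
  - apply (ex_series_scal_l (V := R_NormedModule)), ex_series_inv_half_pole_sqr.
  - intros; now apply is_derive_pf_term.
  - intros; now apply pf_term_bound.
  - intros; now apply ex_series_pf_term.
Qed.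

(** * Expansion of tanh^m / cosh^(1+e) in derivatives of sech or tanh *)

Definition tanh_sech (e m : nat) (t : R) : R := sinh t ^ m / cosh t ^ (m + 1 + e).

Lemma is_derive_tanh_sech e m t :
  is_derive (tanh_sech e m) t
    (INR m * tanh_sech e (pred m) t - INR (m + 1 + e) * tanh_sech e (S m) t).
Proof.
  assert (Hc := cosh_pos t). unfold tanh_sech.
  auto_derive.
  { now apply pow_nonzero, Rgt_not_eq. }
  assert (Hn : forall k, cosh t ^ k <> 0) by (intros; apply pow_nonzero; lra).
  destruct m as [|m].
  - simpl pred. change (0 + 1 + e)%nat with (S e). change (1 + 1 + e)%nat with (S (S e)).
    simpl (INR 0). cbn [pow Nat.pred pred]. assert (H := Hn e).
    field. repeat split; lra.
  - replace (S m + 1 + e)%nat with (S (S (m + e))) by lia.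
    replace (pred (S m) + 1 + e)%nat with (S (m + e)) by (simpl; lia).
    replace (S (S m) + 1 + e)%nat with (S (S (S (m + e)))) by lia.
    simpl pred. cbn [pow Nat.pred pred]. assert (H := Hn (m + e)%nat).
    field. repeat split; lra.
Qed.

(** F_0 is sech itself for [e = 0] and sech^2 = tanh' for [e = 1]: in both cases the derivative of
    order [e] of H. *)
Lemma tanh_sech_0 e t : e = 0%nat \/ e = 1%nat -> tanh_sech e 0 t = pf_series e e t.
Proof.
  assert (Hc := cosh_pos t). intros [-> | ->].
  - unfold pf_series. rewrite (is_series_unique _ _ (proj1 (pf_series_0 t))).
    unfold tanh_sech. simpl. field. lra.
  - rewrite <- (is_derive_unique _ _ _ (is_derive_pf_series 1 0 t (or_intror eq_refl))).
    rewrite (Derive_ext _ tanh).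
    2:{ intros u. apply is_series_unique, pf_series_0. }
    unfold tanh_sech. symmetry. apply is_derive_unique.
    unfold tanh. auto_derive.
    { lra. }
    assert (Hcs := cosh_sqr_minus_sinh_sqr t).
    transitivity ((cosh t * cosh t - sinh t * sinh t) / (cosh t * cosh t)); [field; lra|].
    rewrite Hcs. simpl. field. lra.
Qed.

(* [tanh_sech e m = sum_k tanh_coef e m k * pf_series e k]. *)
Fixpoint tanh_coef (e m k : nat) {struct m} : R :=
  match m with
  | O => if Nat.eqb k e then 1 else 0
  | S m => (match m with O => 0 | S m' => INR m * tanh_coef e m' k end -
            match k with O => 0 | S k => tanh_coef e m k end) / INR (m + 1 + e)
  end.

Lemma tanh_coef_S e m k :
  INR (m + 1 + e) * tanh_coef e (S m) k =
  INR m * tanh_coef e (pred m) k - match k with O => 0 | S k => tanh_coef e m k end.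
Proof.
  assert (H : INR (m + 1 + e) <> 0) by (apply not_0_INR; lia).
  destruct m as [|m].
  - change (tanh_coef e 1 k) with
      ((0 - match k with O => 0 | S k => tanh_coef e 0 k end) / INR (0 + 1 + e)).
    simpl (INR 0). field. exact H.
  - change (tanh_coef e (S (S m)) k) with
      ((INR (S m) * tanh_coef e m k - match k with O => 0 | S k => tanh_coef e (S m) k end)
       / INR (S m + 1 + e)).
    simpl pred. field. exact H.
Qed.

(** Two-step induction phrased with [pred]. At [m = 0] the recurrences multiply the term of index
    [pred m] by [INR m = 0], so one inductive step covers every m. *)
Lemma nat_ind2 (P : nat -> Prop) :
  P 0%nat -> (forall m, P (pred m) -> P m -> P (S m)) -> forall m, P m.
Proof.
  intros H0 HS m. enough (P (pred m) /\ P m) by tauto.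
  induction m as [|m [IH1 IH2]]; simpl; auto.
Qed.

(** The parity condition reflects that F_m has the parity of m and H^(k) that of k + e. *)
Lemma tanh_coef_eq_0 e m k :
  (m + e < k)%nat \/ Nat.odd (m + k + e) = true -> tanh_coef e m k = 0.
Proof.
  revert k. induction m as [|m IH1 IH2] using nat_ind2; intros k Hk.
  - simpl. destruct (Nat.eqb_spec k e) as [->|]; [|reflexivity].
    exfalso. destruct Hk as [Hk|Hk]; [lia|].
    rewrite Nat.add_0_l, Nat.odd_add, Bool.xorb_nilpotent in Hk. discriminate.
  - apply Rmult_eq_reg_l with (INR (m + 1 + e)); [|apply not_0_INR; lia].
    rewrite tanh_coef_S, Rmult_0_r.
    replace (INR m * tanh_coef e (pred m) k) with 0.
    2:{ destruct m as [|m]; [simpl; ring|]. rewrite IH1; [ring|].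
        destruct Hk as [Hk|Hk]; [left; simpl; lia|right].
        replace (S (S m) + k + e)%nat with (S (S (m + k + e))) in Hk by lia. exact Hk. }
    destruct k as [|k]; [ring|]. rewrite IH2; [ring|].
    destruct Hk as [Hk|Hk]; [left; lia|right].
    replace (S m + S k + e)%nat with (S (S (m + k + e))) in Hk by lia. exact Hk.
Qed.

(** The undifferentiated tanh never occurs, in accordance with F_m vanishing at infinity; this
    matters because tanh t / t has no convergent integral. *)
Lemma tanh_coef_1_0 m : tanh_coef 1 m 0 = 0.
Proof.
  induction m as [|m IH1 IH2] using nat_ind2; [reflexivity|].
  apply Rmult_eq_reg_l with (INR (m + 1 + 1)); [|apply not_0_INR; lia].
  rewrite tanh_coef_S, IH1. ring.
Qed.

Lemma sum_f_R0_scal_l (a : R) (f : nat -> R) (n : nat) :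
  sum_f_R0 (fun k => a * f k) n = a * sum_f_R0 f n.
Proof. rewrite scal_sum. apply sum_eq. intros; ring. Qed.

Lemma sum_f_R0_shift (f g : nat -> R) (n : nat) :
  sum_f_R0 (fun k => match k with O => 0 | S k => f k end * g k) (S n) =
  sum_f_R0 (fun k => f k * g (S k)) n.
Proof. rewrite decomp_sum by lia. simpl. ring. Qed.

(* Both sides of [F_m' = m F_(m-1) - (m+1+e) F_(m+1)], paired with an arbitrary
   sequence of values. *)
Lemma tanh_coef_sum_rec (e m K : nat) (g : nat -> R) :
  INR (m + 1 + e) * sum_f_R0 (fun k => tanh_coef e (S m) k * g k) (S K) =
  INR m * sum_f_R0 (fun k => tanh_coef e (pred m) k * g k) (S K) -
  sum_f_R0 (fun k => tanh_coef e m k * g (S k)) K.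
Proof.
  rewrite <- (sum_f_R0_shift (tanh_coef e m) g), <- !sum_f_R0_scal_l, <- minus_sum.
  apply sum_eq. intros k _.
  rewrite <- !Rmult_assoc, tanh_coef_S. ring.
Qed.

(** The length [K] is left free so that the sums for m - 1, m and m + 1 can be cut at compatible
    places; the extra coefficients vanish. *)
Lemma tanh_sech_expansion e m K t : e = 0%nat \/ e = 1%nat -> (m + e <= K)%nat ->
  tanh_sech e m t = sum_f_R0 (fun k => tanh_coef e m k * pf_series e k t) K.
Proof.
  intros He. revert K t. induction m as [|m IH1 IH2] using nat_ind2; intros K t HK.
  - rewrite tanh_sech_0 by exact He.
    replace K with (e + (K - e))%nat by lia.
    generalize (K - e)%nat as d. induction d as [|d IHd].
    + rewrite Nat.add_0_r. destruct He as [-> | ->]; simpl; ring.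
    + rewrite Nat.add_succ_r. cbn [sum_f_R0]. rewrite <- IHd, tanh_coef_eq_0; [ring|left; lia].
  - destruct K as [|K]; [lia|].
    apply Rmult_eq_reg_l with (INR (m + 1 + e)); [|apply not_0_INR; lia].
    rewrite tanh_coef_sum_rec, <- (IH1 (S K)) by lia.
    (* Differentiating F_m in closed form and termwise, then comparing, determines F_(m+1). *)
    assert (D1 := is_derive_tanh_sech e m t).
    assert (D2 : is_derive (tanh_sech e m) t
      (sum_f_R0 (fun k => tanh_coef e m k * pf_series e (S k) t) K)).
    { apply is_derive_ext with
        (fun t => sum_f_R0 (fun k => tanh_coef e m k * pf_series e k t) K).
      - intros u. symmetry. apply IH2. lia.
      - apply is_derive_sum_f_R0 with (df := fun k t => tanh_coef e m k * pf_series e (S k) t).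
        intros k. apply (is_derive_scal (pf_series e k)). now apply is_derive_pf_series. }
    assert (E := is_derive_unique _ _ _ D1). rewrite (is_derive_unique _ _ _ D2) in E. lra.
Qed.

(** The integral over (0, oo), encoded by a primitive normalised to 0 at the left end. Linearity,
    parts and substitution become operations on primitives; Riemann integrals appear only at the
    final change of variable. *)
Definition improper (g : R -> R) (L : R) : Prop :=
  exists V : R -> R,
    (forall t, 0 < t -> is_derive V t (g t)) /\
    filterlim V (at_right 0) (locally 0) /\
    filterlim V (Rbar_locally p_infty) (locally L).

Lemma improper_ext (f g : R -> R) (L : R) :
  (forall t, 0 < t -> f t = g t) -> improper f L -> improper g L.
Proof.
  intros E [V [HV [H0 HL]]]. exists V. split; [|split]; auto.
  intros t Ht. rewrite <- E; auto.
Qed.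

Lemma filterlim_lin_comb {T : Type} (F : (T -> Prop) -> Prop) {FF : Filter F}
  (f g : T -> R) (a b x y : R) :
  filterlim f F (locally x) -> filterlim g F (locally y) ->
  filterlim (fun t => a * f t + b * g t) F (locally (a * x + b * y)).
Proof.
  intros Hf Hg.
  assert (Ha := filterlim_comp _ _ _ f (fun x => a * x) _ _ _ Hf
    (filterlim_scal_r (K := R_AbsRing) (V := R_NormedModule) a x)).
  assert (Hb := filterlim_comp _ _ _ g (fun x => b * x) _ _ _ Hg
    (filterlim_scal_r (K := R_AbsRing) (V := R_NormedModule) b y)).
  apply (filterlim_comp_2 _ _ Rplus Ha Hb).
  apply (filterlim_plus (V := R_NormedModule)).
Qed.

Lemma improper_lin_comb (f g : R -> R) (a b L1 L2 : R) :
  improper f L1 -> improper g L2 ->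
  improper (fun t => a * f t + b * g t) (a * L1 + b * L2).
Proof.
  intros [V [HV [V0 VL]]] [W [HW [W0 WL]]].
  exists (fun t => a * V t + b * W t). split; [|split].
  - intros t Ht. apply (is_derive_plus (K := R_AbsRing) (V := R_NormedModule)).
    + apply (is_derive_scal V); auto.
    + apply (is_derive_scal W); auto.
  - assert (H := filterlim_lin_comb (at_right 0) V W a b 0 0 V0 W0).
    replace (a * 0 + b * 0) with 0 in H by ring. exact H.
  - apply filterlim_lin_comb; auto. apply Rbar_locally_filter.
Qed.

Lemma improper_0 : improper (fun _ => 0) 0.
Proof.
  exists (fun _ => 0). split; [|split].
  - intros. apply (is_derive_const (K := R_AbsRing) (V := R_NormedModule)).
  - apply filterlim_const.
  - apply filterlim_const.
Qed.

(** The alternative [a = 0] admits an f whose integral diverges, as happens for the terms of the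
    expansion with the wrong parity. *)
Lemma improper_scal (f : R -> R) (a L : R) :
  (a = 0 \/ improper f L) -> improper (fun t => a * f t) (a * L).
Proof.
  intros [-> | H].
  - rewrite Rmult_0_l. apply improper_ext with (fun _ => 0); [intros; symmetry; apply Rmult_0_l|].
    apply improper_0.
  - replace (a * L) with (a * L + 0 * 0) by ring.
    apply improper_ext with (fun t => a * f t + 0 * 0); [intros; ring|].
    apply (improper_lin_comb f (fun _ => 0)); [exact H|apply improper_0].
Qed.

Lemma improper_sum (f : nat -> R -> R) (L : nat -> R) (K : nat) :
  (forall k, (k <= K)%nat -> improper (f k) (L k)) ->
  improper (fun t => sum_f_R0 (fun k => f k t) K) (sum_f_R0 L K).
Proof.
  induction K as [|K IH]; intros H; cbn [sum_f_R0].
  - apply H. lia.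
  - rewrite <- (Rmult_1_l (sum_f_R0 L K)), <- (Rmult_1_l (L (S K))).
    apply improper_ext with
      (fun t => 1 * sum_f_R0 (fun k => f k t) K + 1 * f (S K) t); [intros; ring|].
    apply improper_lin_comb; [apply IH; intros|]; apply H; lia.
Qed.

(** * Improper integrals *)

(* The value of [int_0^oo pf_series e r t / t dt] for [r + 1 = 2 p + e]. *)
Definition pf_moment (e r : nat) : R :=
  (-1) ^ ((r + 1) / 2) * INR (fact r) / PI ^ r *
  Lerch_Phi (2 * INR e - 1) (INR (S r)) (1 / 2).

(** The form that the integration produces: each partial fraction contributes its coefficient times
    (-1)^p and pi / 2, the limit of [w_im_prim]. The factor 2 and this pi / 2 cancel one power of pi
    from [half_pole j ^ S r]. *)
Lemma pf_moment_eq e p r : e = 0%nat \/ e = 1%nat -> S r = (2 * p + e)%nat ->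
  pf_moment e r =
  Series (fun j => (2 * INR e - 1) ^ j * (2 * INR (fact r) / half_pole j ^ S r) *
    (-1) ^ p * (PI / 2)).
Proof.
  intros He Hr. unfold pf_moment, Lerch_Phi.
  replace ((r + 1) / 2)%nat with p.
  2:{ apply Nat.div_unique with e; lia. }
  rewrite <- Series_scal_l. apply Series_ext. intros j.
  assert (Hj := pos_INR j). assert (HP := PI_RGT_0).
  rewrite Rpower_pow by lra. unfold half_pole. rewrite Rpow_mult_distr.
  change (PI ^ S r) with (PI * PI ^ r).
  field. repeat split; try apply pow_nonzero; lra.
Qed.

Lemma improper_pf_series e p r : e = 0%nat \/ e = 1%nat -> (1 <= p)%nat ->
  S r = (2 * p + e)%nat ->
  improper (fun t => pf_series e r t / t) (pf_moment e r).
Proof.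
  intros He Hp Hr.
  rewrite (pf_moment_eq e p r He Hr).
  set (b := fun j => (2 * INR e - 1) ^ j * (2 * INR (fact r) / half_pole j ^ S r) * (-1) ^ p).
  set (M := fun j => 2 * INR (fact r) * / half_pole j ^ 2).
  (* [p >= 1] forces [r >= 1], so the exponent [S r] is at least 2 and the [b j] are absolutely
     summable. *)
  destruct r as [|r']; [lia|]. set (r := S r') in *.
  assert (Hfact := INR_fact_lt_0 r).
  assert (Hb : forall j, Rabs (b j) <= M j).
  { intros j. unfold b, M. rewrite !Rabs_mult, sign_pow_bound, pow_1_abs by exact He.
    assert (H := inv_half_pole_pow_le r' j).
    unfold Rdiv. change (S r) with (2 + r')%nat.
    rewrite Rabs_right by (apply Rle_ge, Rmult_le_pos; lra).
    rewrite Rmult_1_l, Rmult_1_r. apply Rmult_le_compat_l; lra. }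
  assert (HM : forall C, ex_series (fun j => M j * C)).
  { intros C. apply ex_series_ext with (fun j => 2 * INR (fact r) * C * / half_pole j ^ 2).
    - intros j. unfold M. apply Rmult_eq_reg_l with 1; [ring|lra].
    - apply (ex_series_scal_l (V := R_NormedModule)), ex_series_inv_half_pole_sqr. }
  assert (HM0 : forall j, 0 <= M j).
  { intros j. eapply Rle_trans; [apply Rabs_pos|apply Hb]. }
  set (v := fun j t => b j * w_im_prim r (t / half_pole j)).
  set (dv := fun j t => b j / half_pole j * w_im_quot (S r) (t / half_pole j)).
  assert (Hv : forall j t, Rabs (v j t) <= M j * (2 + INR r)).
  { intros j t. unfold v. rewrite Rabs_mult.
    apply Rmult_le_compat; auto using Rabs_pos. apply w_im_prim_bound. }
  assert (HV : forall t, is_derive (fun t => Series (fun j => v j t)) t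
     (Series (fun j => dv j t))).
  { apply is_derive_Series with (fun j => M j * INR (S r)).
    - apply HM.
    - intros j t. apply is_derive_rescale, is_derive_w_im_prim.
    - intros j t. unfold dv. rewrite Rabs_mult.
      apply Rmult_le_compat; auto using Rabs_pos; [|apply w_im_quot_bound].
      assert (H := half_pole_lb j).
      assert (H1 : 0 < / half_pole j <= 1).
      { split; [apply Rinv_0_lt_compat; lra|]. rewrite <- Rinv_1.
        apply Rinv_le_contravar; lra. }
      unfold Rdiv. rewrite Rabs_mult, (Rabs_right (/ _)) by lra.
      rewrite <- (Rmult_1_r (M j)). apply Rmult_le_compat; auto using Rabs_pos; lra.
    - intros t. apply (@ex_series_le R_AbsRing R_CompleteNormedModule) with
        (fun j => M j * (2 + INR r)); [|apply HM]. intros j. apply Hv. }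
  exists (fun t => Series (fun j => v j t)). split; [|split].
  - intros t Ht.
    replace (pf_series e r t / t) with (Series (fun j => dv j t)); [apply HV|].
    unfold pf_series, Rdiv. rewrite <- Series_scal_r. apply Series_ext.
    intros j. unfold dv, pf_term, b.
    replace (S r - e)%nat with (2 * p)%nat by lia.
    rewrite rot_double, (w_im_quot_correct (S r)).
    assert (H := half_pole_lb j). field. repeat split; try apply pow_nonzero; lra.
  (* The primitive is differentiable on the whole line, so its right limit at 0 is its value there,
     and every [v j 0] is 0. *)
  - assert (Hc : continuous (fun t => Series (fun j => v j t)) 0).
    { apply (ex_derive_continuous (K := R_AbsRing) (V := R_NormedModule)).
      eexists. apply HV. }
    unfold continuous in Hc.
    replace (Series (fun j => v j 0)) with 0 in Hc.
    + apply filterlim_filter_le_1 with (2 := Hc). apply filter_le_within.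
    + transitivity (Series (fun j => 0 * b j)); [rewrite Series_scal_l; ring|].
      apply Series_ext. intros j. unfold v. replace (0 / half_pole j) with 0 by (unfold Rdiv; ring).
      rewrite w_im_prim_0. ring.
  (* The bound on [w_im_prim] is uniform in t, so t may tend to infinity term by term. *)
  - apply (@filterlim_Series_dominated R (Rbar_locally p_infty) (Rbar_locally_filter p_infty)
      v (fun j => b j * (PI / 2)) (fun j => M j * (2 + INR r))).
    + apply HM.
    + apply filter_forall. intros t j. apply Hv.
    + intros j. unfold v.
      assert (H := half_pole_lb j).
      apply (filterlim_comp _ _ _ (fun t => w_im_prim r (t / half_pole j)) (fun x => b j * x)
        _ (locally (PI / 2))).
      * apply (filterlim_comp _ _ _ (fun t => t / half_pole j) (w_im_prim r)
          _ (Rbar_locally p_infty)).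
        -- intros P [C HC]. exists (C * half_pole j). intros t Ht. apply HC.
           apply Rmult_lt_reg_r with (half_pole j); [lra|].
           unfold Rdiv. rewrite Rmult_assoc, Rinv_l; lra.
        -- apply filterlim_w_im_prim.
      * apply (filterlim_scal_r (K := R_AbsRing) (V := R_NormedModule)).
Qed.

Lemma sinh_le t : 0 <= t -> 0 <= sinh t <= t * cosh t.
Proof.
  intros Ht.
  assert (H1 : Rabs (sinh t - sinh 0) <= cosh t * (t - 0)).
  { apply Rabs_increment_le with cosh; [exact Ht| |].
    - intros x _. apply is_derive_Reals, derivable_pt_lim_sinh.
    - intros x Hx. rewrite Rabs_right by (apply Rle_ge, Rlt_le, cosh_pos).
      destruct (Req_dec x t) as [->|Hxt]; [lra|].
      destruct (MVT_gen cosh x t sinh) as [c [Hc E]].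
      + intros; apply is_derive_Reals, derivable_pt_lim_cosh.
      + intros y _. apply derivable_continuous_pt. exists (sinh y). apply derivable_pt_lim_cosh.
      + rewrite Rmin_left, Rmax_right in Hc by lra.
        assert (0 <= sinh c).
        { destruct (proj1 Hc) as [H0|H0].
          - rewrite <- sinh_0. apply Rlt_le, sinh_lt. lra.
          - destruct (Req_dec c 0) as [->|]; [rewrite sinh_0; lra|].
            rewrite <- sinh_0. apply Rlt_le, sinh_lt. lra. }
        nra. }
  assert (H2 : 0 <= sinh t).
  { destruct Ht as [Ht| <-]; [|rewrite sinh_0; lra].
    rewrite <- sinh_0. now apply Rlt_le, sinh_lt. }
  rewrite sinh_0, !Rminus_0_r, Rabs_right in H1; lra.
Qed.

(** From 0 <= tanh t <= min(t, 1) and cosh t >= 1. The first bound kills the boundary term of the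
    integration by parts at 0, the second at infinity. *)
Lemma tanh_sech_bound e m t : 0 <= t ->
  Rabs (tanh_sech e m t) <= t ^ m /\ Rabs (tanh_sech e m t) <= 1.
Proof.
  intros Ht. assert (Hc := cosh_pos t). assert (Hs := sinh_le t Ht).
  assert (Hc1 : 1 <= cosh t).
  { assert (H := cosh_sqr_minus_sinh_sqr t). nra. }
  assert (E : tanh_sech e m t = (sinh t / cosh t) ^ m * / cosh t ^ (1 + e)).
  { unfold tanh_sech. rewrite <- Nat.add_assoc, pow_add. unfold Rdiv.
    rewrite Rpow_mult_distr, pow_inv. field. split; apply pow_nonzero; lra. }
  assert (H0 : 0 <= sinh t / cosh t).
  { apply Rmult_le_pos; [lra|]. now apply Rlt_le, Rinv_0_lt_compat. }
  assert (H1 : sinh t / cosh t <= t).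
  { apply Rmult_le_reg_r with (cosh t); [lra|]. unfold Rdiv.
    rewrite Rmult_assoc, Rinv_l; lra. }
  assert (H2 : sinh t / cosh t <= 1).
  { apply Rmult_le_reg_r with (cosh t); [lra|]. unfold Rdiv.
    rewrite Rmult_assoc, Rinv_l; [|lra]. unfold sinh, cosh.
    assert (H := exp_pos (- t)). lra. }
  assert (H3 : 0 < / cosh t ^ (1 + e) <= 1).
  { split; [apply Rinv_0_lt_compat, pow_lt; lra|].
    rewrite <- Rinv_1. apply Rinv_le_contravar; [lra|]. now apply pow_R1_Rle. }
  assert (H4 := pow_le _ m H0).
  rewrite E, Rabs_right by (apply Rle_ge, Rmult_le_pos; lra).
  assert (H5 : (sinh t / cosh t) ^ m <= t ^ m) by (apply pow_incr; lra).
  assert (H6 : (sinh t / cosh t) ^ m <= 1).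
  { rewrite <- (pow1 m). apply pow_incr. lra. }
  split; nra.
Qed.

(* Integration by parts: the boundary term [tanh_sech e m t / t^n] vanishes at
   both ends. *)
Lemma improper_by_parts e m n L1 L2 : (1 <= n < m)%nat ->
  improper (fun t => tanh_sech e (pred m) t / t ^ n) L1 ->
  improper (fun t => tanh_sech e (S m) t / t ^ n) L2 ->
  improper (fun t => tanh_sech e m t / t ^ S n)
    ((INR m * L1 - INR (m + 1 + e) * L2) / INR n).
Proof.
  intros Hnm H1 H2.
  assert (Hn : 0 < INR n) by (apply lt_0_INR; lia).
  destruct (improper_lin_comb _ _ (INR m / INR n) (- INR (m + 1 + e) / INR n) _ _ H1 H2)
    as [V [HV [V0 VL]]].
  exists (fun t => 1 * V t + - / INR n * (tanh_sech e m t / t ^ n)). split; [|split].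
  - intros t Ht.
    assert (HF := is_derive_tanh_sech e m t).
    assert (Hnz : t ^ n <> 0) by (apply pow_nonzero; lra).
    assert (HB : is_derive (fun t => tanh_sech e m t / t ^ n) t
      ((INR m * tanh_sech e (pred m) t - INR (m + 1 + e) * tanh_sech e (S m) t) / t ^ n
        - INR n * (tanh_sech e m t / t ^ S n))).
    { auto_derive.
      - repeat split; auto. now eexists; apply HF.
      - change (Derive (fun x => tanh_sech e m x) t) with (Derive (tanh_sech e m) t).
        rewrite (is_derive_unique _ _ _ HF).
        destruct n as [|n]; [lia|]. simpl Init.Nat.pred.
        change (t ^ S (S n)) with (t * (t * t ^ n)). change (t ^ S n) with (t * t ^ n) in *.
        field. split; [|lra]. intros H. apply Hnz. rewrite H. ring. }
    replace (tanh_sech e m t / t ^ S n) with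
      (1 * (INR m / INR n * (tanh_sech e (pred m) t / t ^ n) +
          - INR (m + 1 + e) / INR n * (tanh_sech e (S m) t / t ^ n)) +
       - / INR n * ((INR m * tanh_sech e (pred m) t - INR (m + 1 + e) * tanh_sech e (S m) t) / t ^ n
        - INR n * (tanh_sech e m t / t ^ S n))).
    + apply (is_derive_plus (K := R_AbsRing) (V := R_NormedModule)).
      * apply (is_derive_scal V). auto.
      * apply (is_derive_scal (fun t => tanh_sech e m t / t ^ n)). exact HB.
    + change (t ^ S n) with (t * t ^ n). field. repeat split; lra.
  - enough (HB0 : filterlim (fun t => tanh_sech e m t / t ^ n) (at_right 0) (locally 0)).
    { assert (H := filterlim_lin_comb (at_right 0) _ _ 1 (- / INR n) _ _ V0 HB0).
      replace (1 * 0 + - / INR n * 0) with 0 in H by ring. exact H. }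
    apply (proj2 (filterlim_locally_R _ _ _)). intros eps He.
    assert (Hd : 0 < Rmin eps 1) by (apply Rmin_glb_lt; lra).
    exists (mkposreal _ Hd). intros t Hball Ht.
    unfold ball in Hball; simpl in Hball.
    unfold AbsRing_ball, abs, minus, plus, opp in Hball; simpl in Hball.
    rewrite Ropp_0, Rplus_0_r, Rabs_right in Hball by lra.
    assert (B1 := Rmin_l eps 1). assert (B2 := Rmin_r eps 1).
    destruct (tanh_sech_bound e m t ltac:(lra)) as [Hb _].
    rewrite Rminus_0_r. unfold Rdiv. rewrite Rabs_mult.
    assert (Hpn : 0 < t ^ n) by (apply pow_lt; lra).
    rewrite (Rabs_right (/ _)) by (apply Rle_ge, Rlt_le, Rinv_0_lt_compat, Hpn).
    apply Rmult_lt_reg_r with (t ^ n); [exact Hpn|].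
    rewrite Rmult_assoc, Rinv_l, Rmult_1_r by lra.
    eapply Rle_lt_trans; [exact Hb|].
    (* Since [n < m], at least one factor t is left after division by [t ^ n]. *)
    replace m with (S (m - n - 1) + n)%nat by lia. rewrite pow_add.
    apply Rmult_lt_compat_r; [exact Hpn|]. simpl.
    assert (t ^ (m - n - 1) <= 1).
    { rewrite <- (pow1 (m - n - 1)). apply pow_incr. lra. }
    assert (0 < t ^ (m - n - 1)) by (apply pow_lt; lra). nra.
  - replace ((INR m * L1 - INR (m + 1 + e) * L2) / INR n) with
      (1 * (INR m / INR n * L1 + - INR (m + 1 + e) / INR n * L2) + - / INR n * 0)
      by (field; lra).
    apply filterlim_lin_comb; [apply Rbar_locally_filter|apply VL|].
    apply filterlim_locally_R; [apply Rbar_locally_filter|]. intros eps He.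
    exists (Rmax 1 (/ eps)). intros t Ht.
    assert (B1 := Rmax_l 1 (/ eps)). assert (B2 := Rmax_r 1 (/ eps)).
    destruct (tanh_sech_bound e m t ltac:(lra)) as [_ Hb].
    rewrite Rminus_0_r. unfold Rdiv. rewrite Rabs_mult.
    assert (Hpn : t <= t ^ n).
    { destruct n as [|n]; [lia|]. simpl.
      assert (1 <= t ^ n) by (apply pow_R1_Rle; lra). nra. }
    rewrite (Rabs_right (/ _)) by (apply Rle_ge, Rlt_le, Rinv_0_lt_compat; lra).
    assert (/ t ^ n <= / t) by (apply Rinv_le_contravar; lra).
    assert (/ t < eps).
    { rewrite <- (Rinv_inv eps). apply Rinv_lt_contravar; [|lra].
      apply Rmult_lt_0_compat; [apply Rinv_0_lt_compat|]; lra. }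
    assert (0 < / t ^ n) by (apply Rinv_0_lt_compat; lra).
    assert (Hp := Rabs_pos (tanh_sech e m t)). nra.
Qed.

(** Induction on n with m free: parts lead from exponent n + 2 at m to exponent n + 1 at m - 1 and m
    + 1, which preserves the parity condition and the inequality. *)
Lemma improper_tanh_sech e n m K : e = 0%nat \/ e = 1%nat ->
  (n < m)%nat -> Nat.odd (m + n) = true -> (m + e <= K)%nat ->
  improper (fun t => tanh_sech e m t / t ^ S n)
    (sum_f_R0 (fun k => tanh_coef e m k * pf_moment e (k + n)) K / INR (fact n)).
Proof.
  intros He. revert m K. induction n as [|n IH]; intros m K Hnm Hodd HK.
  - simpl fact. simpl INR. unfold Rdiv. rewrite Rinv_1, Rmult_1_r.
    rewrite Nat.add_0_r in Hodd.
    apply improper_ext with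
      (fun t => sum_f_R0 (fun k => tanh_coef e m k * (pf_series e k t / t)) K).
    { intros t Ht. rewrite (tanh_sech_expansion e m K t He HK), pow_1.
      rewrite Rmult_comm, scal_sum. apply sum_eq. intros; unfold Rdiv; ring. }
    apply (improper_sum (fun k t => tanh_coef e m k * (pf_series e k t / t))).
    intros k _. rewrite Nat.add_0_r. apply improper_scal.
    (* Either the coefficient vanishes, by parity or because the term is tanh itself, or
       [k + 1 = 2 p + e] with [p >= 1] and the moment exists. *)
    destruct (Nat.odd (m + k + e)) eqn:Hpar.
    { left. apply tanh_coef_eq_0. auto. }
    apply Nat.odd_spec in Hodd. destruct Hodd as [i Hi].
    assert (Hev : Nat.even (m + k + e) = true).
    { rewrite <- Nat.negb_odd, Hpar. reflexivity. }
    apply Nat.even_spec in Hev. destruct Hev as [l Hl].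
    destruct (Nat.eq_dec k 0) as [->|Hk].
    + left. destruct He as [-> | ->]; [lia|apply tanh_coef_1_0].
    + right. apply improper_pf_series with ((k + 1) / 2)%nat; auto.
      * apply Nat.div_le_lower_bound; lia.
      * assert (E : ((k + 1) / 2 = l - i - e)%nat).
        { symmetry. apply Nat.div_unique with e; lia. }
        rewrite E. lia.
  - assert (Hpar : Nat.odd (pred m + n) = true /\ Nat.odd (S m + n) = true).
    { rewrite Nat.add_succ_r in Hodd. split; [|exact Hodd].
      destruct m as [|m]; [lia|]. exact Hodd. }
    assert (H1 := IH (pred m) (S K) ltac:(lia) (proj1 Hpar) ltac:(lia)).
    assert (H2 := IH (S m) (S K) ltac:(lia) (proj2 Hpar) ltac:(lia)).
    assert (H := improper_by_parts e m (S n) _ _ ltac:(lia) H1 H2).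
    replace (sum_f_R0 (fun k => tanh_coef e m k * pf_moment e (k + S n)) K / INR (fact (S n)))
      with ((INR m * (sum_f_R0 (fun k => tanh_coef e (pred m) k * pf_moment e (k + n)) (S K)
          / INR (fact n)) -
        INR (m + 1 + e) * (sum_f_R0 (fun k => tanh_coef e (S m) k * pf_moment e (k + n)) (S K)
          / INR (fact n))) / INR (S n)); [exact H|].
    (* The coefficient recurrence, paired with the moments of index [k + n], is exactly the relation
       given by parts. *)
    assert (E := tanh_coef_sum_rec e m K (fun k => pf_moment e (k + n))).
    cbv beta in E.
    rewrite (sum_eq (fun k => tanh_coef e m k * pf_moment e (k + S n))
      (fun k => tanh_coef e m k * pf_moment e (S k + n))).
    2:{ intros k _. now rewrite Nat.add_succ_r. }
    rewrite fact_simpl, mult_INR.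
    assert (Hf := INR_fact_neq_0 n). assert (HS : INR (S n) <> 0) by (apply not_0_INR; lia).
    match goal with |- (?a * (?x / ?f) - ?b * (?y / ?f)) / ?s = _ =>
      transitivity ((a * x - b * y) / (s * f)); [field; auto|f_equal; lra] end.
Qed.

(** * Coefficients of powers of arcsin *)

(** [Derive_n] is total, so rules for coefficients need existence of derivatives near 0; an open
    interval provides it around each of its points. *)
Definition smooth (f : R -> R) : Prop :=
  forall n z, -1 < z < 1 -> ex_derive_n f n z.

Lemma locally_interval (a b z : R) (P : R -> Prop) :
  a < z < b -> (forall y, a < y < b -> P y) -> locally z P.
Proof.
  intros Hz HP. assert (Hd : 0 < Rmin (z - a) (b - z)) by (apply Rmin_glb_lt; lra).
  exists (mkposreal _ Hd). intros y Hy. apply HP.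
  unfold ball in Hy; simpl in Hy. unfold AbsRing_ball, abs, minus, plus, opp in Hy; simpl in Hy.
  assert (H1 := Rmin_l (z - a) (b - z)). assert (H2 := Rmin_r (z - a) (b - z)).
  apply Rabs_def2 in Hy. lra.
Qed.

Lemma smooth_locally (f : R -> R) n z : smooth f -> -1 < z < 1 ->
  locally z (fun y => forall k, (k <= n)%nat -> ex_derive_n f k y).
Proof.
  intros Hf Hz. apply locally_interval with (-1) 1; auto.
Qed.

Lemma Derive_n_of_derive (f df : R -> R) n z :
  (forall y, -1 < y < 1 -> is_derive f y (df y)) -> -1 < z < 1 ->
  Derive_n f (S n) z = Derive_n df n z.
Proof.
  intros H Hz. rewrite <- Nat.add_1_r, <- Derive_n_comp.
  apply Derive_n_ext_loc. apply locally_interval with (-1) 1; auto.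
  intros y Hy. apply is_derive_unique. auto.
Qed.

Lemma ex_derive_n_of_derive (f df : R -> R) n z :
  (forall y, -1 < y < 1 -> is_derive f y (df y)) -> -1 < z < 1 ->
  ex_derive_n df n z -> ex_derive_n f (S n) z.
Proof.
  intros H Hz Hn. destruct n as [|n].
  - exists (df z). now apply H.
  - apply (ex_derive_ext_loc (Derive_n df n)); [|exact Hn].
    apply locally_interval with (-1) 1; auto.
    intros y Hy. symmetry. now apply Derive_n_of_derive.
Qed.

Lemma smooth_scal a f : smooth f -> smooth (fun z => a * f z).
Proof. intros Hf n z Hz. apply ex_derive_n_scal_l. now apply Hf. Qed.

Lemma coeff_plus r f g : smooth f -> smooth g ->
  coeff_at_0 r (fun z => f z + g z) = coeff_at_0 r f + coeff_at_0 r g.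
Proof.
  intros Hf Hg. unfold coeff_at_0. rewrite Derive_n_plus.
  - field. apply INR_fact_neq_0.
  - apply smooth_locally; [exact Hf|lra].
  - apply smooth_locally; [exact Hg|lra].
Qed.

Lemma coeff_scal r a f : coeff_at_0 r (fun z => a * f z) = a * coeff_at_0 r f.
Proof. unfold coeff_at_0. rewrite Derive_n_scal_l. unfold Rdiv. ring. Qed.

Lemma coeff_derive r f df :
  (forall y, -1 < y < 1 -> is_derive f y (df y)) ->
  coeff_at_0 r df = INR (S r) * coeff_at_0 (S r) f.
Proof.
  intros H. unfold coeff_at_0. rewrite (Derive_n_of_derive f df r 0 H) by lra.
  rewrite fact_simpl, mult_INR. field. split; [apply INR_fact_neq_0|apply not_0_INR; lia].
Qed.

Lemma Derive_n_mult_id (g : R -> R) n z : smooth g -> -1 < z < 1 ->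
  Derive_n (fun z => z * g z) (S n) z = z * Derive_n g (S n) z + INR (S n) * Derive_n g n z.
Proof.
  intros Hg. revert z. induction n as [|n IH]; intros z Hz.
  - simpl. assert (H := Hg 1%nat z Hz). simpl in H.
    rewrite Derive_mult, Derive_id; [| |exact H].
    + change (Derive (fun x => g x) z) with (Derive g z). ring.
    + apply ex_derive_id.
  - change (Derive_n (fun z => z * g z) (S (S n)) z) with
      (Derive (Derive_n (fun z => z * g z) (S n)) z).
    rewrite (Derive_ext_loc _ (fun z => z * Derive_n g (S n) z + INR (S n) * Derive_n g n z)).
    2:{ apply locally_interval with (-1) 1; auto. }
    assert (H1 := Hg (S n) z Hz). assert (H2 := Hg (S (S n)) z Hz).
    change (ex_derive (Derive_n g n) z) in H1.
    change (ex_derive (Derive_n g (S n)) z) in H2.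
    rewrite Derive_plus, Derive_mult, Derive_id, Derive_scal; auto using ex_derive_id.
    + change (Derive (Derive_n g n) z) with (Derive_n g (S n) z).
      change (Derive (Derive_n g (S n)) z) with (Derive_n g (S (S n)) z).
      change (Derive (fun x => Derive_n g n x) z) with (Derive_n g (S n) z).
      rewrite (S_INR (S n)). ring.
    + apply (ex_derive_mult (fun z => z) (Derive_n g (S n))); auto using ex_derive_id.
    + apply (ex_derive_scal (Derive_n g n)). exact H1.
Qed.

Lemma coeff_mult_id r g : smooth g ->
  coeff_at_0 (S r) (fun z => z * g z) = coeff_at_0 r g.
Proof.
  intros Hg. unfold coeff_at_0. rewrite Derive_n_mult_id by (auto; lra).
  rewrite fact_simpl, mult_INR. field. split; [apply INR_fact_neq_0|apply not_0_INR; lia].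
Qed.

(** The span of this family is closed under differentiation; [s] is real because differentiating
    arcsin lowers it by 1/2. *)
Definition asin_monomial (i : nat) (s : R) (k : nat) (z : R) : R :=
  z ^ i * (Rpower (1 - z ^ 2) s * asin z ^ k).

Lemma is_derive_asin z : -1 < z < 1 -> is_derive asin z (Rpower (1 - z ^ 2) (- (1 / 2))).
Proof.
  intros Hz. apply is_derive_Reals.
  assert (H := derive_pt_asin z Hz).
  replace (Rpower (1 - z ^ 2) (- (1 / 2))) with (1 / sqrt (1 - z²)).
  - exact (derive_pt_eq_1 _ _ _ _ H).
  - rewrite Rpower_Ropp. replace (1 / 2) with (/ 2) by field.
    rewrite Rpower_sqrt by nra. unfold Rsqr, Rdiv. rewrite Rmult_1_l.
    simpl. now rewrite Rmult_1_r.
Qed.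

Lemma is_derive_Rpower_one_minus_sqr s z : -1 < z < 1 ->
  is_derive (fun z => Rpower (1 - z ^ 2) s) z (- 2 * s * z * Rpower (1 - z ^ 2) (s - 1)).
Proof.
  intros Hz. assert (H : 0 < 1 - z ^ 2) by nra.
  replace (s - 1) with (s + - (1)) by ring. rewrite Rpower_plus, Rpower_Ropp, Rpower_1 by exact H.
  unfold Rpower. auto_derive; [simpl in H |- *; lra|].
  replace (1 + - (z * (z * 1))) with (1 - z ^ 2) by (simpl; ring).
  field. simpl in H |- *; lra.
Qed.

Lemma is_derive_asin_monomial i s k z : -1 < z < 1 ->
  is_derive (asin_monomial i s k) z
    (INR i * asin_monomial (pred i) s k z +
     (- 2 * s) * asin_monomial (S i) (s - 1) k z +
     INR k * asin_monomial i (s - 1 / 2) (pred k) z).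
Proof.
  intros Hz. unfold asin_monomial.
  assert (HA := is_derive_asin z Hz).
  assert (HR := is_derive_Rpower_one_minus_sqr s z Hz).
  assert (Es : Rpower (1 - z ^ 2) (s - 1 / 2) =
    Rpower (1 - z ^ 2) s * Rpower (1 - z ^ 2) (- (1 / 2))) by apply Rpower_plus.
  set (q := fun z => Rpower (1 - z ^ 2) s).
  change (is_derive q z (- 2 * s * z * Rpower (1 - z ^ 2) (s - 1))) in HR.
  change (is_derive (fun z => z ^ i * (q z * asin z ^ k)) z
    (INR i * (z ^ pred i * (q z * asin z ^ k)) +
     (- 2 * s) * (z ^ S i * (Rpower (1 - z ^ 2) (s - 1) * asin z ^ k)) +
     INR k * (z ^ i * (Rpower (1 - z ^ 2) (s - 1 / 2) * asin z ^ pred k)))).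
  rewrite Es. change (Rpower (1 - z ^ 2) s) with (q z).
  auto_derive; [repeat split; eexists; eassumption|].
  change (Derive (fun x => asin x) z) with (Derive asin z).
  change (Derive (fun x => q x) z) with (Derive q z).
  rewrite (is_derive_unique _ _ _ HA), (is_derive_unique _ _ _ HR).
  change (Init.Nat.pred i) with (pred i). change (Init.Nat.pred k) with (pred k).
  simpl (z ^ S i). ring.
Qed.

Lemma smooth_asin_monomial i s k : smooth (asin_monomial i s k).
Proof.
  (* All parameters stay quantified, since differentiation changes [i], [s] and [k]. *)
  assert (H : forall n N, (n <= N)%nat -> forall i s k z, -1 < z < 1 ->
    ex_derive_n (asin_monomial i s k) n z).
  2:{ intros n z Hz. now apply (H n n). }
  clear i s k. intros n N. revert n. induction N as [|N IH]; intros n HN i s k z Hz.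
  - replace n with O by lia. exact I.
  - destruct n as [|n]; [exact I|].
    apply ex_derive_n_of_derive with
      (fun z => INR i * asin_monomial (pred i) s k z +
       (- 2 * s) * asin_monomial (S i) (s - 1) k z +
       INR k * asin_monomial i (s - 1 / 2) (pred k) z); auto.
    + intros; now apply is_derive_asin_monomial.
    + apply ex_derive_n_plus; apply locally_interval with (-1) 1; auto; intros y Hy l Hl.
      * apply ex_derive_n_plus; apply locally_interval with (-1) 1; auto;
          intros x Hx j Hj; apply ex_derive_n_scal_l; apply IH; auto; lia.
      * apply ex_derive_n_scal_l; apply IH; auto; lia.
Qed.

Definition asin_coef (e m k : nat) : R :=
  coeff_at_0 (m + e) (fun z => Rpower (1 - z ^ 2) ((INR m - 1) / 2) * asin z ^ k).

Lemma coeff_ext r f g : (forall z, f z = g z) -> coeff_at_0 r f = coeff_at_0 r g.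
Proof. intros H. unfold coeff_at_0. now rewrite (Derive_n_ext f g). Qed.

Lemma asin_coef_monomial e m k :
  asin_coef e m k = coeff_at_0 (m + e) (asin_monomial 0 ((INR m - 1) / 2) k).
Proof. apply coeff_ext. intros z. unfold asin_monomial. simpl. ring. Qed.

(* Extracts the coefficient of z^(m+e) in the derivative of
   (1 - z^2)^(m/2) arcsin^k z. *)
Lemma asin_coef_rec e m k :
  INR (m + 1 + e) * asin_coef e (S m) k =
  INR k * asin_coef e m (pred k) - INR m * asin_coef e (pred m) k.
Proof.
  rewrite !asin_coef_monomial.
  replace ((INR (S m) - 1) / 2) with (INR m / 2) by (rewrite S_INR; field).
  replace (m + 1 + e)%nat with (S (m + e)) by lia. change (S m + e)%nat with (S (m + e)).
  rewrite <- (coeff_derive _ _ _ (fun y => is_derive_asin_monomial 0 (INR m / 2) k y)).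
  assert (S1 := smooth_asin_monomial 0 (INR m / 2 - 1 / 2) (pred k)).
  assert (S2 := smooth_asin_monomial 1 (INR m / 2 - 1) k).
  rewrite (coeff_ext _ _ (fun z => (- INR m) * asin_monomial 1 (INR m / 2 - 1) k z +
     INR k * asin_monomial 0 (INR m / 2 - 1 / 2) (pred k) z)).
  2:{ intros z. simpl (INR 0). field. }
  rewrite coeff_plus, !coeff_scal by (now apply smooth_scal).
  replace (INR m / 2 - 1 / 2) with ((INR m - 1) / 2) by field.
  destruct m as [|m].
  - simpl (INR 0). ring.
  (* The factor z shifts the coefficient index by one, and the remaining exponent m/2 - 1 is the one
     that [asin_coef] has at m - 1. *)
  - simpl pred. rewrite <- (coeff_mult_id (m + e)) by apply smooth_asin_monomial.
    rewrite (coeff_ext _ (fun z => z * _) (asin_monomial 1 (INR (S m) / 2 - 1) k)).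
    + change (S m + e)%nat with (S (m + e)). ring.
    + intros z. unfold asin_monomial.
      replace ((INR m - 1) / 2) with (INR (S m) / 2 - 1) by (rewrite S_INR; field).
      simpl. ring.
Qed.

(** arcsin^k z / sqrt(1 - z^2) starts with z^k and has the parity of k. *)
Lemma asin_coef_0 e k : e = 0%nat \/ e = 1%nat ->
  asin_coef e 0 k = if Nat.eqb k e then 1 else 0.
Proof.
  assert (E1 : forall s, Rpower (1 - 0 ^ 2) s = 1).
  { intros s. unfold Rpower. replace (1 - 0 ^ 2) with 1 by ring.
    rewrite ln_1, Rmult_0_r. apply exp_0. }
  intros [-> | ->].
  - unfold asin_coef, coeff_at_0. cbn [Nat.add fact Derive_n]. rewrite E1, asin_0.
    destruct k as [|k]; simpl; field.
  - rewrite asin_coef_monomial. unfold coeff_at_0. cbn [Nat.add fact Derive_n].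
    rewrite (is_derive_unique _ _ _ (is_derive_asin_monomial 0 _ k 0 ltac:(lra))).
    unfold asin_monomial. rewrite !E1, asin_0.
    destruct k as [|[|k]]; simpl; field.
Qed.

(** The two recurrences differ by a global sign and by a factor k. Each step lowers [l] by one, so
    (-1)^l absorbs the sign, and 1 / k! absorbs the factor. *)
Lemma tanh_coef_asin_coef e m k l : e = 0%nat \/ e = 1%nat -> (m + k = 2 * l + e)%nat ->
  tanh_coef e m k = (-1) ^ l * asin_coef e m k / INR (fact k).
Proof.
  intros He. revert k l. induction m as [|m IH1 IH2] using nat_ind2; intros k l Hl.
  - rewrite asin_coef_0 by exact He. simpl tanh_coef.
    destruct (Nat.eqb_spec k e) as [->|Hk].
    + replace l with 0%nat by lia. destruct He as [-> | ->]; simpl; field.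
    + unfold Rdiv. ring.
  - apply Rmult_eq_reg_l with (INR (m + 1 + e)); [|apply not_0_INR; lia].
    rewrite tanh_coef_S.
    replace (INR (m + 1 + e) * ((-1) ^ l * asin_coef e (S m) k / INR (fact k))) with
      ((-1) ^ l * (INR (m + 1 + e) * asin_coef e (S m) k) / INR (fact k))
      by (field; apply INR_fact_neq_0).
    rewrite asin_coef_rec.
    (* [l = 0] leaves only [m = k = 0], where both sides are 0. *)
    destruct l as [|l].
    { replace m with 0%nat by lia. replace k with 0%nat by lia. simpl. field. }
    replace (INR m * tanh_coef e (pred m) k) with
      (INR m * ((-1) ^ l * asin_coef e (pred m) k / INR (fact k))).
    2:{ destruct m as [|m]; [simpl; ring|]. rewrite (IH1 k l); [reflexivity|simpl; lia]. }
    destruct k as [|k].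
    + simpl. field.
    + rewrite (IH2 k l) by lia. rewrite fact_simpl, mult_INR. simpl pred. cbn [pow].
      field. split; [apply INR_fact_neq_0|apply not_0_INR; lia].
Qed.

(** * Substitution and reindexing *)

Lemma exp_2_arctanh x : -1 < x < 1 -> exp (2 * arctanh x) = (1 + x) / (1 - x).
Proof.
  intros Hx. unfold arctanh.
  replace (2 * (ln ((1 + x) / (1 - x)) / 2)) with (ln ((1 + x) / (1 - x))) by field.
  apply exp_ln, Rdiv_lt_0_compat; lra.
Qed.

Lemma sinh_cosh_arctanh x : -1 < x < 1 ->
  sinh (arctanh x) = x * cosh (arctanh x) /\ (1 - x ^ 2) * cosh (arctanh x) ^ 2 = 1.
Proof.
  intros Hx. assert (H := exp_2_arctanh x Hx).
  replace (2 * arctanh x) with (arctanh x + arctanh x) in H by ring.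
  rewrite exp_plus in H.
  assert (Hi : exp (arctanh x) * exp (- arctanh x) = 1).
  { rewrite <- exp_plus, Rplus_opp_r. apply exp_0. }
  assert (Hp := exp_pos (arctanh x)). unfold sinh, cosh.
  set (a := exp (arctanh x)) in *. set (b := exp (- arctanh x)) in *.
  assert (Hs : (1 - x) * a = (1 + x) * b).
  { apply Rmult_eq_reg_r with a; [|lra].
    replace ((1 - x) * a * a) with ((1 - x) * (a * a)) by ring. rewrite H.
    replace ((1 + x) * b * a) with ((1 + x) * (a * b)) by ring. rewrite Hi. field. lra. }
  assert (Ha2 : (1 - x) * (a * a) = 1 + x) by (rewrite H; field; lra).
  assert (Hb2 : (1 + x) * (b * b) = 1 - x).
  { rewrite <- Rmult_assoc, <- Hs, Rmult_assoc, Hi. ring. }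
  split; [lra|].
  replace ((1 - x ^ 2) * ((a + b) / 2) ^ 2) with
    (((1 + x) * ((1 - x) * (a * a)) + 2 * (1 - x ^ 2) * (a * b) +
      (1 - x) * ((1 + x) * (b * b))) / 4) by field.
  rewrite Ha2, Hb2, Hi. field.
Qed.

Lemma arctanh_pos x : 0 < x < 1 -> 0 < arctanh x.
Proof.
  intros Hx. unfold arctanh. enough (0 < ln ((1 + x) / (1 - x))) by lra.
  rewrite <- ln_1. apply ln_increasing; [lra|].
  apply Rmult_lt_reg_r with (1 - x); [lra|].
  unfold Rdiv. rewrite Rmult_assoc, Rinv_l; lra.
Qed.

Lemma is_derive_arctanh x : -1 < x < 1 -> is_derive arctanh x (/ (1 - x ^ 2)).
Proof.
  intros Hx. unfold arctanh. auto_derive.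
  - split; [lra|]. split; [|trivial]. apply Rdiv_lt_0_compat; lra.
  - field. repeat split; try lra; nra.
Qed.

(** The target filter is one-sided because a primitive in [improper] has a prescribed limit only
    from the right. *)
Lemma filterlim_arctanh_0 : filterlim arctanh (at_right 0) (at_right 0).
Proof.
  assert (Hc : continuous arctanh 0).
  { apply (ex_derive_continuous (K := R_AbsRing) (V := R_NormedModule)).
    eexists. apply is_derive_arctanh. lra. }
  unfold continuous in Hc.
  replace (arctanh 0) with 0 in Hc.
  2:{ unfold arctanh. replace ((1 + 0) / (1 - 0)) with 1 by field. rewrite ln_1. field. }
  intros P HP. unfold at_right, within in HP.
  assert (H := Hc _ HP). unfold filtermap in H |- *.
  unfold at_right, within.
  assert (H1 : locally 0 (fun x => x < 1)) by (apply open_lt; lra).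
  apply (filter_imp _ _ (fun x (Hx : _ /\ _) (Hx0 : 0 < x) =>
    proj1 Hx (arctanh_pos x (conj Hx0 (proj2 Hx))))).
  now apply filter_and.
Qed.

Lemma filterlim_arctanh_1 : filterlim arctanh (at_left 1) (Rbar_locally p_infty).
Proof.
  intros P [M HM].
  (* For 0 < x < 1, exp (2 arctanh x) = (1+x)/(1-x) exceeds 1/(1-x), hence exp (2M) as soon as 1 - x
     < exp (-2M). *)
  assert (Hd : 0 < Rmin (exp (- (2 * M))) 1).
  { apply Rmin_glb_lt; [apply exp_pos|lra]. }
  exists (mkposreal _ Hd). intros x Hb Hx. apply HM.
  unfold ball in Hb; simpl in Hb. unfold AbsRing_ball, abs, minus, plus, opp in Hb; simpl in Hb.
  assert (B1 := Rmin_l (exp (- (2 * M))) 1). assert (B2 := Rmin_r (exp (- (2 * M))) 1).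
  apply Rabs_def2 in Hb.
  assert (Hxx : -1 < x < 1) by lra.
  enough (H : 2 * M < 2 * arctanh x) by lra.
  apply exp_lt_inv. rewrite exp_2_arctanh by exact Hxx.
  assert (E : exp (2 * M) * exp (- (2 * M)) = 1).
  { rewrite <- exp_plus, Rplus_opp_r. apply exp_0. }
  assert (Hp := exp_pos (2 * M)).
  apply Rmult_lt_reg_r with (1 - x); [lra|].
  unfold Rdiv. rewrite Rmult_assoc, Rinv_l by lra. nra.
Qed.

(** The Jacobian of t = arctanh x is 1/(1-x^2) = c^2 with c = cosh t; both sides equal x^m
    c^(1-e). *)
Lemma tanh_sech_arctanh e m x : e = 0%nat \/ e = 1%nat -> 0 < x < 1 ->
  tanh_sech e m (arctanh x) * / (1 - x ^ 2) = x ^ m / Rpower (1 - x ^ 2) ((1 - INR e) / 2).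
Proof.
  intros He Hx. destruct (sinh_cosh_arctanh x ltac:(lra)) as [Es Ec].
  assert (Hc := cosh_pos (arctanh x)). set (c := cosh (arctanh x)) in *.
  assert (Hq : 0 < 1 - x ^ 2) by nra.
  unfold tanh_sech. rewrite Es. fold c. rewrite Rpow_mult_distr, <- Nat.add_assoc, pow_add.
  assert (Hcm : c ^ m <> 0) by (apply pow_nonzero; lra).
  replace (/ (1 - x ^ 2)) with (c ^ 2).
  2:{ apply Rmult_eq_reg_l with (1 - x ^ 2); [|lra]. rewrite Ec. field. lra. }
  destruct He as [-> | ->].
  - simpl INR. replace ((1 - 0) / 2) with (/ 2) by field.
    rewrite Rpower_sqrt by exact Hq.
    replace (sqrt (1 - x ^ 2)) with (/ c).
    + simpl. field. repeat split; auto; lra.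
    + symmetry. apply sqrt_lem_1; [lra|apply Rlt_le, Rinv_0_lt_compat, Hc|].
      apply Rmult_eq_reg_r with (c ^ 2); [|apply pow_nonzero; lra].
      rewrite Ec. field. lra.
  - simpl INR. replace ((1 - 1) / 2) with 0 by field.
    rewrite Rpower_O by exact Hq. simpl. field. repeat split; auto; lra.
Qed.

Lemma is_RInt_gen_arctanh e m n L : e = 0%nat \/ e = 1%nat ->
  improper (fun t => tanh_sech e m t / t ^ n) L ->
  is_RInt_gen
    (fun x => x ^ m / (Rpower (1 - x ^ 2) ((1 - INR e) / 2) * arctanh x ^ n))
    (at_right 0) (at_left 1) L.
Proof.
  intros He [V [HV [V0 VL]]].
  set (f := fun x => x ^ m / (Rpower (1 - x ^ 2) ((1 - INR e) / 2) * arctanh x ^ n)).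
  unfold is_RInt_gen.
  apply filterlimi_lim_ext_loc with
    (f := fun ab => minus (V (arctanh (snd ab))) (V (arctanh (fst ab)))).
  (* Separating the endpoints at 1/2 ensures a < b and keeps [a, b] inside (0, 1). *)
  - exists (fun a => 0 < a < 1 / 2) (fun b => 1 / 2 < b < 1).
    + exists (mkposreal (1 / 2) ltac:(lra)). intros y Hy H0.
      unfold ball in Hy; simpl in Hy. unfold AbsRing_ball, abs, minus, plus, opp in Hy; simpl in Hy.
      apply Rabs_def2 in Hy. lra.
    + exists (mkposreal (1 / 2) ltac:(lra)). intros y Hy H0.
      unfold ball in Hy; simpl in Hy. unfold AbsRing_ball, abs, minus, plus, opp in Hy; simpl in Hy.
      apply Rabs_def2 in Hy. lra.
    + intros a b Ha Hb. simpl.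
      apply (is_RInt_derive (fun x => V (arctanh x)) f); rewrite Rmin_left, Rmax_right by lra;
        intros x Hx; assert (Hx' : 0 < x < 1) by lra; assert (HA := arctanh_pos x Hx').
      * replace (f x) with (scal (/ (1 - x ^ 2)) (tanh_sech e m (arctanh x) / arctanh x ^ n)).
        -- apply (is_derive_comp (K := R_AbsRing) (V := R_NormedModule) V arctanh); auto.
           apply is_derive_arctanh. lra.
        -- change (/ (1 - x ^ 2) * (tanh_sech e m (arctanh x) / arctanh x ^ n) = f x).
           unfold f, Rdiv at 2. rewrite Rinv_mult, <- Rmult_assoc.
           change (x ^ m * / Rpower (1 - x ^ 2) ((1 - INR e) / 2)) with
             (x ^ m / Rpower (1 - x ^ 2) ((1 - INR e) / 2)).
           rewrite <- (tanh_sech_arctanh e m x He Hx'). unfold Rdiv. ring.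
      * apply (ex_derive_continuous (K := R_AbsRing) (V := R_NormedModule)).
        unfold f. assert (HD := is_derive_arctanh x ltac:(lra)). unfold Rpower.
        assert (0 < 1 - x ^ 2) by nra.
        auto_derive. repeat split; auto.
        -- now eexists; apply HD.
        -- apply Rmult_integral_contrapositive_currified.
           ++ apply Rgt_not_eq, exp_pos.
           ++ apply pow_nonzero. lra.
  - assert (H1 : filterlim (fun ab : R * R => V (arctanh (snd ab)))
      (filter_prod (at_right 0) (at_left 1)) (locally L)).
    { apply filterlim_comp with (2 := VL).
      apply filterlim_comp with (2 := filterlim_arctanh_1). apply filterlim_snd. }
    assert (H0 : filterlim (fun ab : R * R => V (arctanh (fst ab)))
      (filter_prod (at_right 0) (at_left 1)) (locally 0)).
    { apply filterlim_comp with (2 := V0).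
      apply filterlim_comp with (2 := filterlim_arctanh_0). apply filterlim_fst. }
    assert (H := filterlim_lin_comb _ _ _ 1 (-1) _ _ H1 H0).
    replace (1 * L + -1 * 0) with L in H by ring.
    apply filterlim_ext with (2 := H). intros ab.
    unfold minus, plus, opp; simpl. ring.
Qed.

Lemma sum_f_R0_parity (g : nat -> R) (r I : nat) :
  (forall k, (k < r)%nat -> g k = 0) -> (forall i, g (2 * i + 1 + r)%nat = 0) ->
  sum_f_R0 g (2 * I + r) = sum_f_R0 (fun i => g (2 * i + r)%nat) I.
Proof.
  intros H0 H1. induction I as [|I IH].
  - simpl. destruct r as [|r]; [reflexivity|]. cbn [sum_f_R0].
    rewrite (sum_eq g (fun _ => 0)) by (intros; apply H0; lia).
    rewrite sum_cte. ring.
  - replace (2 * S I + r)%nat with (S (S (2 * I + r))) by lia. cbn [sum_f_R0].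
    rewrite IH. replace (S (2 * I + r)) with (2 * I + 1 + r)%nat by lia.
    replace (2 * S I + r)%nat with (S (2 * I + 1 + r)) by lia.
    rewrite H1. ring.
Qed.

Lemma sum_n_m_sum_f_R0 (a : nat -> R) (P I : nat) :
  sum_n_m a P (P + I) = sum_f_R0 (fun i => a (P + i)%nat) I.
Proof.
  induction I as [|I IH].
  - rewrite Nat.add_0_r, sum_n_n. simpl. now rewrite Nat.add_0_r.
  - rewrite Nat.add_succ_r, sum_n_Sm by lia. rewrite IH. cbn [sum_f_R0].
    now rewrite Nat.add_succ_r.
Qed.

(** The substitution is k = 2p + e - (n+1), the exponent of t being [S n]. The factorials of the
    moment, the parts and the coefficients combine into the binomial. *)
Lemma moment_sum_reindex e m n : e = 0%nat \/ e = 1%nat ->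
  (n < m)%nat -> Nat.odd (m + n) = true ->
  sum_f_R0 (fun k => tanh_coef e m k * pf_moment e (k + n)) (m + e) / INR (fact n) =
  (-1) ^ ((m - S n) / 2)%nat *
  sum_n_m
    (fun p : nat =>
       Binomial.C (2 * p - 1 + e)%nat (S n - 1)%nat *
       (Lerch_Phi (2 * INR e - 1) (INR (2 * p + e)) (1 / 2) / PI ^ (2 * p - 1 + e)%nat) *
       coeff_at_0 (m + e)%nat
         (fun z : R => Rpower (1 - z ^ 2) ((INR m - 1) / 2) * asin z ^ (2 * p + e - S n)%nat))
    ((S n + 1) / 2)%nat ((m + S n) / 2)%nat.
Proof.
  intros He Hnm Hodd. apply Nat.odd_spec in Hodd. destruct Hodd as [s Hs].
  (* [d] is 1 for even n and 0 for odd n; the lowest p then corresponds to k = e + d. *)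
  assert (Hq : exists q d, n = (2 * q + 1 - d)%nat /\ (d <= 1)%nat).
  { destruct (Nat.Even_or_Odd n) as [[q Eq]|[q Eq]].
    - exists q, 1%nat. lia.
    - exists q, 0%nat. lia. }
  destruct Hq as [q [d [Hq Hd]]].
  set (P := (q + 1)%nat). set (I := (s - q)%nat).
  assert (EP : ((S n + 1) / 2 = P)%nat).
  { symmetry. apply Nat.div_unique with (1 - d)%nat; lia. }
  assert (EQ : ((m + S n) / 2 = P + I)%nat).
  { symmetry. apply Nat.div_unique with 0%nat; lia. }
  assert (ED : exists D, (m - S n = 2 * D)%nat) by (exists (s - n)%nat; lia).
  destruct ED as [D HD].
  assert (EDD : ((m - S n) / 2 = D)%nat).
  { symmetry. apply Nat.div_unique with 0%nat; lia. }
  rewrite EP, EQ, EDD, sum_n_m_sum_f_R0.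
  replace (m + e)%nat with (2 * I + (e + d))%nat at 1 by lia.
  rewrite sum_f_R0_parity.
  - unfold Rdiv at 1. rewrite Rmult_comm, <- !sum_f_R0_scal_l. apply sum_eq. intros i _.
    set (p := (P + i)%nat). set (k := (2 * i + (e + d))%nat).
    assert (Hk : (2 * p + e - S n = k)%nat) by lia.
    rewrite (tanh_coef_asin_coef e m k (D + p) He) by lia.
    unfold asin_coef, pf_moment, Binomial.C. rewrite Hk.
    replace (S (k + n)) with (2 * p + e)%nat by lia.
    replace (2 * p - 1 + e)%nat with (k + n)%nat by lia.
    replace ((k + n + 1) / 2)%nat with p.
    2:{ apply Nat.div_unique with e; lia. }
    replace (k + n - (S n - 1))%nat with k by lia.
    replace (S n - 1)%nat with n by lia.
    rewrite pow_add.
    (* The moment carries (-1)^p and the coefficient (-1)^(D+p); only (-1)^D is left. *)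
    assert (Hpp : (-1) ^ p * (-1) ^ p = 1).
    { rewrite <- Rpow_mult_distr. replace (-1 * -1) with 1 by ring. apply pow1. }
    assert (HPI : PI ^ (k + n) <> 0) by (apply pow_nonzero; assert (H := PI_RGT_0); lra).
    assert (F1 := INR_fact_neq_0 n). assert (F2 := INR_fact_neq_0 k).
    set (A := coeff_at_0 _ _). set (L := Lerch_Phi _ _ _).
    transitivity (((-1) ^ p * (-1) ^ p) * ((-1) ^ D *
      (INR (fact (k + n)) / (INR (fact n) * INR (fact k)) * (L / PI ^ (k + n)) * A))).
    + field. auto.
    + rewrite Hpp. ring.
  (* Below e + d parity removes every term except possibly k = 0 with e = 1, which is tanh
     itself. *)
  - intros k Hk. rewrite Rmult_eq_0_compat_r; [reflexivity|].
    destruct (Nat.odd (m + k + e)) eqn:Hp; [apply tanh_coef_eq_0; auto|].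
    assert (Hev : Nat.even (m + k + e) = true).
    { rewrite <- Nat.negb_odd, Hp. reflexivity. }
    apply Nat.even_spec in Hev. destruct Hev as [l Hl].
    destruct He as [-> | ->]; [lia|].
    replace k with 0%nat by lia. apply tanh_coef_1_0.
  - intros i. rewrite Rmult_eq_0_compat_r; [reflexivity|].
    apply tanh_coef_eq_0. right.
    apply Nat.odd_spec. exists (I + i + e + d)%nat. lia.
Qed.

(** * Lerch values at 1/2 as beta, lambda and zeta values *)

Lemma Lerch_half_eq q r :
  Lerch_Phi q (INR r) (1 / 2) =
  2 ^ r * Series (fun j => q ^ j / Rpower (2 * INR j + 1) (INR r)).
Proof.
  unfold Lerch_Phi. rewrite <- Series_scal_l. apply Series_ext. intros j.
  assert (Hj := pos_INR j). rewrite !Rpower_pow by lra.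
  replace (INR j + 1 / 2) with ((2 * INR j + 1) * / 2) by field.
  rewrite Rpow_mult_distr, pow_inv. field. split; apply pow_nonzero; lra.
Qed.

Lemma ex_series_zeta r : (2 <= r)%nat -> ex_series (fun j => / (INR j + 1) ^ r).
Proof.
  intros Hr.
  apply (@ex_series_le R_AbsRing R_CompleteNormedModule) with
    (fun j => PI ^ 2 * / half_pole j ^ 2).
  2:{ apply (ex_series_scal_l (V := R_NormedModule)), ex_series_inv_half_pole_sqr. }
  intros j. unfold norm; simpl; unfold abs; simpl.
  assert (Hj := pos_INR j). assert (HP := PI_RGT_0).
  assert (Hpow : 0 < (INR j + 1) ^ r) by (apply pow_lt; lra).
  rewrite Rabs_right by (apply Rle_ge, Rlt_le, Rinv_0_lt_compat, Hpow).
  unfold half_pole.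
  replace (PI * (PI * 1) * / (PI * (INR j + 1 / 2) * (PI * (INR j + 1 / 2) * 1)))
    with (/ (INR j + 1 / 2) ^ 2) by (field; lra).
  apply Rinv_le_contravar; [apply pow_lt; lra|].
  apply Rle_trans with ((INR j + 1) ^ 2); [apply pow_incr; lra|].
  apply Rle_pow; [lra|exact Hr].
Qed.

(** Indices start at 0, so even j carry the odd denominators, which give lambda, and odd j the even
    ones, which give 2^(-r) zeta. *)
Lemma lambda_zeta r : (2 <= r)%nat ->
  2 ^ r * Dirichlet_lambda (INR r) = (2 ^ r - 1) * Riemann_zeta (INR r).
Proof.
  intros Hr.
  set (a := fun j => / (INR j + 1) ^ r).
  assert (Ez : Riemann_zeta (INR r) = Series a).
  { apply Series_ext. intros j. assert (Hj := pos_INR j). unfold a.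
    rewrite Rpower_pow by lra. apply Rmult_1_l. }
  assert (El : Dirichlet_lambda (INR r) = Series (fun j => a (2 * j)%nat)).
  { apply Series_ext. intros j. assert (Hj := pos_INR j). unfold a.
    rewrite Rpower_pow by lra. rewrite mult_INR. apply Rmult_1_l. }
  assert (Hex := ex_series_zeta r Hr). fold a in Hex.
  assert (Eodd : forall j, a (2 * j + 1)%nat = / 2 ^ r * a j).
  { intros j. unfold a.
    replace (INR (2 * j + 1) + 1) with (2 * (INR j + 1))
      by (rewrite plus_INR, mult_INR; simpl; ring).
    rewrite Rpow_mult_distr, Rinv_mult. reflexivity. }
  assert (Hex2 : ex_series (fun j => a (2 * j)%nat)).
  { apply (@ex_series_le R_AbsRing R_CompleteNormedModule) with a; [|exact Hex].
    intros j. unfold norm; simpl; unfold abs; simpl. unfold a.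
    assert (Hj := pos_INR j).
    rewrite Rabs_right by (apply Rle_ge, Rlt_le, Rinv_0_lt_compat, pow_lt;
      assert (H := pos_INR (j + (j + 0))); lra).
    apply Rinv_le_contravar; [apply pow_lt; lra|].
    apply pow_incr. split; [lra|]. apply Rplus_le_compat_r, le_INR. lia. }
  assert (Hsplit : is_series a (Series (fun j => a (2 * j)%nat) + 1 * (/ 2 ^ r * Series a))).
  { assert (H := is_pseries_odd_even a 1 (Series (fun j => a (2 * j)%nat)) (/ 2 ^ r * Series a)).
    assert (Hps : forall (b : nat -> R) (l x : R), x = 1 -> is_series b l <-> is_pseries b x l).
    { intros b l x ->. unfold is_pseries.
      assert (E : forall n, b n = scal (pow_n 1 n) (b n)).
      { intros n. rewrite pow_n_pow, pow1. symmetry. apply Rmult_1_l. }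
      split; apply is_series_ext; intros n; [|symmetry]; apply E. }
    apply (Hps _ _ 1); [reflexivity|]. apply H.
    - apply Hps; [ring|]. now apply Series_correct.
    - apply Hps; [ring|].
      apply is_series_ext with (fun j => scal (/ 2 ^ r) (a j)).
      + intros j. rewrite Eodd. reflexivity.
      + apply (is_series_scal_l (V := R_NormedModule)). now apply Series_correct. }
  assert (E := is_series_unique _ _ Hsplit).
  rewrite Ez, El.
  assert (H2 : 2 ^ r <> 0) by (apply pow_nonzero; lra).
  assert (E2 : Series (fun j => a (2 * j)%nat) = Series a - / 2 ^ r * Series a) by lra.
  rewrite E2. field. exact H2.
Qed.

Theorem proposition3p7 :
  forall m n : nat,
  (1 <= n)%nat -> (n <= m)%nat -> ((m + n) mod 2 = 0)%nat ->
  (forall e : nat, e = 0%nat \/ e = 1%nat ->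
     is_RInt_gen
       (fun x : R =>
          x ^ m / (Rpower (1 - x ^ 2) ((1 - INR e) / 2) * arctanh x ^ n))
       (at_right 0) (at_left 1)
       ((-1) ^ ((m - n) / 2)%nat *
        sum_n_m
          (fun p : nat =>
             Binomial.C (2 * p - 1 + e)%nat (n - 1)%nat *
             (Lerch_Phi (2 * INR e - 1) (INR (2 * p + e)) (1 / 2)
                / PI ^ (2 * p - 1 + e)%nat) *
             coeff_at_0 (m + e)%nat
               (fun z : R =>
                  Rpower (1 - z ^ 2) ((INR m - 1) / 2)
                  * asin z ^ (2 * p + e - n)%nat))
          ((n + 1) / 2)%nat ((m + n) / 2)%nat)) /\
  (forall p : nat, (1 <= p)%nat ->
     Lerch_Phi (2 * INR 0 - 1) (INR (2 * p + 0)) (1 / 2)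
       = 2 ^ (2 * p)%nat * Dirichlet_beta (INR (2 * p)) /\
     Lerch_Phi (2 * INR 1 - 1) (INR (2 * p + 1)) (1 / 2)
       = 2 ^ (2 * p + 1)%nat * Dirichlet_lambda (INR (2 * p + 1)) /\
     2 ^ (2 * p + 1)%nat * Dirichlet_lambda (INR (2 * p + 1))
       = (2 ^ (2 * p + 1)%nat - 1) * Riemann_zeta (INR (2 * p + 1))).
Proof.
  intros m n Hn Hnm Hpar. split.
  - intros e He. destruct n as [|n]; [lia|].
    assert (Hodd : Nat.odd (m + n) = true).
    { apply Nat.odd_spec. apply Nat.Div0.mod_divides in Hpar.
      destruct Hpar as [s Hs]. exists (s - 1)%nat. lia. }
    rewrite <- (moment_sum_reindex e m n He) by (auto; lia).
    apply is_RInt_gen_arctanh; [exact He|].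
    apply improper_tanh_sech; auto.
  - intros p Hp. split; [|split].
    + rewrite Nat.add_0_r, Lerch_half_eq. simpl (INR 0).
      replace (2 * 0 - 1) with (-1) by ring. reflexivity.
    + rewrite Lerch_half_eq. f_equal. apply Series_ext. intros j.
      simpl (INR 1). replace (2 * 1 - 1) with 1 by ring. now rewrite pow1.
    + apply lambda_zeta. lia.
Qed.
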